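(* Let $R:\mathbb{R}^n\to]-\infty,+\infty]$ and $J:\mathbb{R}^m\to]-\infty,+\infty]$ be proper, convex and lower semi-continuous, let $L:\mathbb{R}^n\to\mathbb{R}^m$ be linear, and suppose $0\in\mathrm{ran}(\partial R+L^T\circ\partial J\circ L)$. Let $\gamma_R,\gamma_J>0$, $\tau\in[0,1]$, $x_0\in\mathbb{R}^n$, $w_0\in\mathbb{R}^m$, and consider the Primal--Dual iteration $$x_{k+1}=\mathrm{prox}_{\gamma_RR}(x_k-\gamma_RL^Tw_k),\qquad \bar x_{k+1}=x_{k+1}+\tau(x_{k+1}-x_k),\qquad w_{k+1}=\mathrm{prox}_{\gamma_JJ^*}(w_k+\gamma_JL\bar x_{k+1}).$$ If $\tau=1$ and $\gamma_R\gamma_J\|L\|^2<1$, then $(x_k,w_k)\to(x^\star,w^\star)\in\mathcal{X}\times\mathcal{W}$, where $\mathcal{X}$ is the set of solutions of $\min_{x}R(x)+J(Lx)$ and $\mathcal{W}$ is the set of solutions of $\min_{w}R^*(-L^Tw)+J^*(w)$. If, moreover, $R$ is partly smooth at $x^\star$ relative to a $C^2$-manifold $\mathcal{M}^R_{x^\star}$, $J^*$ is partly smooth at $w^\star$ relative to a $C^2$-manifold $\mathcal{M}^{J^*}_{w^\star}$, and the non-degeneracy condition $$-L^Tw^\star\in\mathrm{ri}(\partial R(x^\star))\quad\text{and}\quad Lx^\star\in\mathrm{ri}(\partial J^*(w^\star))$$ holds, then there exists a matrix $M_{\mathrm{PD}}$ such that, with $z_k=\begin{pmatrix}x_k \\ w_k\end{pmatrix}$,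 for all $k$ large enough $$z_{k+1}-z_k=M_{\mathrm{PD}}(z_k-z_{k-1})+o(\|z_k-z_{k-1}\|).$$
   Context: $\mathrm{prox}_{\gamma R}(w)=\mathrm{argmin}_{x}\ \gamma R(x)+\frac12\|x-w\|^2$; $J^*$ and $R^*$ are Fenchel conjugates; $\partial R$ is the convex subdifferential; $\mathrm{ri}$ is the relative interior; $\mathrm{ran}$ is the range; $\mathrm{par}(C)$ is the linear subspace parallel to the affine hull of a convex set $C$. A proper convex lower semi-continuous function $R$ is partly smooth at $\bar x$ relative to a set $\mathcal{M}_{\bar x}$ if $\mathcal{M}_{\bar x}$ is a $C^2$ manifold (embedded submanifold of the ambient Euclidean space) around $\bar x$ and: (Smoothness) $R$ restricted to $\mathcal{M}_{\bar x}$ is $C^2$ around $\bar x$; (Sharpness) the tangent space of $\mathcal{M}_{\bar x}$ at $\bar x$ equals $\mathrm{par}(\partial R(\bar x))^\perp$; (Continuity) the set-valued map $\partial R$ is continuous at $\bar x$ relative to $\mathcal{M}_{\bar x}$. *)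

(* Defs.v *)
From mathcomp Require Import all_boot all_order all_algebra.
From mathcomp Require Import all_classical all_reals all_analysis.

Set Implicit Arguments.
Unset Strict Implicit.
Unset Printing Implicit Defensive.

Import Order.TTheory GRing.Theory Num.Theory.
Import numFieldNormedType.Exports.

Local Open Scope classical_set_scope.
Local Open Scope ring_scope.

(* R^n is 'cV[K]_n.  The norm that the library puts on matrices is the sup norm
   of the entries: it gives the usual topology and the usual C^k maps, but the
   Euclidean norm, which prox and the norm of L refer to, is [enorm]. *)

Section Euclidean.
Context {K : realType}.

Definition dotp {n} (u v : 'cV[K]_n) : K := \sum_i u i 0 * v i 0.

Definition enorm {n} (u : 'cV[K]_n) : K := Num.sqrt (dotp u u).

Definition opnorm {m n} (L : 'M[K]_(m, n)) : K :=
  sup [set enorm (L *m x) | x in [set x | enorm x <= 1]].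

Definition orthoc {n} (C : set 'cV[K]_n) : set 'cV[K]_n :=
  [set v | forall u, C u -> dotp u v = 0].

Definition aff {n} (C : set 'cV[K]_n) : set 'cV[K]_n :=
  [set x | exists k (a : 'I_k -> K) (c : 'I_k -> 'cV[K]_n),
    [/\ forall i, C (c i), \sum_i a i = 1 & x = \sum_i a i *: c i]].

Definition par {n} (C : set 'cV[K]_n) : set 'cV[K]_n :=
  [set u - v | u in aff C & v in aff C].

Definition ri {n} (C : set 'cV[K]_n) : set 'cV[K]_n :=
  [set x | C x /\ \forall y \near x, aff C y -> C y].

End Euclidean.

Section ConvexAnalysis.
Context {K : realType}.
Local Open Scope ereal_scope.

Definition proper {n} (f : 'cV[K]_n -> \bar K) :=
  (forall x, f x != -oo) /\ (exists x, f x < +oo).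

Definition convex {n} (f : 'cV[K]_n -> \bar K) :=
  forall x y (t : K), (0 < t < 1)%R ->
    f (t *: x + (1 - t) *: y)%R <= t%:E * f x + (1 - t)%:E * f y.

Definition proper_convex_lsc {n} (f : 'cV[K]_n -> \bar K) :=
  [/\ proper f, convex f & lower_semicontinuous f].

Definition argmin {T} (f : T -> \bar K) : set T :=
  [set x | forall y, f x <= f y].

(* the argmin itself, a set; it is a singleton when f is proper, convex, lsc *)
Definition prox {n} (f : 'cV[K]_n -> \bar K) (w : 'cV[K]_n) : set 'cV[K]_n :=
  argmin (fun x => f x + (2^-1 * enorm (x - w) ^+ 2)%:E).

Definition fenchel {n} (f : 'cV[K]_n -> \bar K) (u : 'cV[K]_n) : \bar K :=
  ereal_sup [set (dotp u x)%:E - f x | x in setT].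

(* when f is proper, this is empty at the points where f is +oo *)
Definition subdiff {n} (f : 'cV[K]_n -> \bar K) (x : 'cV[K]_n) : set 'cV[K]_n :=
  [set u | forall y, f x + (dotp u (y - x)%R)%:E <= f y].

End ConvexAnalysis.

Definition sv_ran {T U} (S : T -> set U) : set U := \bigcup_x S x.

(* Painleve-Kuratowski outer and inner limits of S along the filter F *)
Definition sv_limsup {T} {U : topologicalType} (F : set_system T)
    (S : T -> set U) : set U :=
  [set u | forall N A, nbhs u N -> F A -> exists2 x, A x & S x `&` N !=set0].

Definition sv_liminf {T} {U : topologicalType} (F : set_system T)
    (S : T -> set U) : set U :=
  [set u | forall N, nbhs u N -> \forall x \near F, S x `&` N !=set0].

Definition sv_continuous_rel {T U : topologicalType} (S : T -> set U)
    (M : set T) (x : T) :=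
  sv_limsup (within M (nbhs x)) S `<=` S x /\
  S x `<=` sv_liminf (within M (nbhs x)) S.

Section PartialSmoothness.
Context {K : realType}.

Definition C2_on {n} (V : set 'cV[K]_n) (g : 'cV[K]_n -> K) :=
  forall x, V x ->
    differentiable g x /\
    forall v, differentiable (fun y => 'd g y v) x /\
    forall u, {for x, continuous (fun y => 'd (fun z => 'd g z v) y u)}.

(* M is, near x, the zero set of a C^2 submersion (Phi_0, ..., Phi_(k-1)) *)
Definition C2_manifold_around {n} (M : set 'cV[K]_n) (x : 'cV[K]_n) :=
  M x /\
  exists (V : set 'cV[K]_n) (k : nat) (Phi : 'I_k -> 'cV[K]_n -> K),
    [/\ open V, V x,
        forall i, C2_on V (Phi i),
        forall y, V y -> forall a : 'I_k -> K, exists v : 'cV[K]_n,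
          forall i, 'd (Phi i) y v = a i
      & forall y, V y -> (M y <-> forall i, Phi i y = 0)].

(* velocities at x of the curves drawn on M *)
Definition tangent_space {n} (M : set 'cV[K]_n) (x : 'cV[K]_n) :
    set 'cV[K]_n :=
  [set v | exists c : K -> 'cV[K]_n,
    [/\ c 0 = x, \forall t \near (0 : K), M (c t)
      & is_derive (0 : K) (1 : K) c v]].

Definition C2_restr_around {n} (f : 'cV[K]_n -> \bar K) (M : set 'cV[K]_n)
    (x : 'cV[K]_n) :=
  exists (V : set 'cV[K]_n) (g : 'cV[K]_n -> K),
    [/\ open V, V x, C2_on V g & forall y, V y -> M y -> f y = (g y)%:E].

Definition partly_smooth {n} (f : 'cV[K]_n -> \bar K) (x : 'cV[K]_n)
    (M : set 'cV[K]_n) :=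
  [/\ C2_manifold_around M x,
      C2_restr_around f M x,
      tangent_space M x = orthoc (par (subdiff f x))
    & sv_continuous_rel (subdiff f) M x].

End PartialSmoothness.

Section PrimalDual.
Context {K : realType} {n m : nat}.
Variables (R : 'cV[K]_n -> \bar K) (J : 'cV[K]_m -> \bar K) (L : 'M[K]_(m, n)).

Definition primal_sol : set 'cV[K]_n :=
  argmin (fun x => R x + J (L *m x))%E.

Definition dual_sol : set 'cV[K]_m :=
  argmin (fun w => fenchel R (- (L^T *m w)) + fenchel J w)%E.

Definition primal_dual_iteration (gR gJ tau : K)
    (x xbar : nat -> 'cV[K]_n) (w : nat -> 'cV[K]_m) :=
  forall k,
    [/\ prox (fun y => gR%:E * R y)%E (x k - gR *: (L^T *m w k)) (x k.+1),
        xbar k.+1 = x k.+1 + tau *: (x k.+1 - x k)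
      & prox (fun v => gJ%:E * fenchel J v)%E
          (w k + gJ *: (L *m xbar k.+1)) (w k.+1)].

End PrimalDual.

(* Main.v *)
From Pilot Require Import Defs.
From HB Require Import structures.
From mathcomp Require Import all_boot all_order all_algebra.
From mathcomp Require Import all_classical all_reals all_analysis.
From mathcomp Require Import ring lra.
Import Pilot.Defs.
Import Order.TTheory GRing.Theory Num.Theory.
Import numFieldNormedType.Exports.
Local Open Scope classical_set_scope.
Local Open Scope ring_scope.

Set Implicit Arguments.
Unset Strict Implicit.
Unset Printing Implicit Defensive.

(* For tau = 1 the iteration is the proximal point method for the monotone
   operator (x, w) |-> (dR x + L^T w, dJ* w - L x) in the metric
   [[1 / gR, - L^T], [- L, 1 / gJ]], which is positive definite because
   gR gJ |L|^2 < 1: the distance to every saddle point decreases, and a cluster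
   point is a saddle point, hence the limit.

   Let f be partly smooth at xb relative to M, with ub in ri (df xb).  Pairs
   (x, u) of the graph of df near (xb, ub) have x in M, and there
   u = grad g x + sum_i l_i grad Phi_i x, where M = {Phi = 0} and f = g on M.
   Let H be the Hessian of g + sum_i l_i Phi_i at (xb, ub); it is positive
   semidefinite on T = ker (D Phi xb), since f (y) >= f (xb) + <ub, y - xb>.
   For two such pairs, with differences a of the points and b of the
   subgradients, a is tangent to M and b - H a is normal to M, up to small
   relative errors; so the T-components of (1 + gam H) a and of a + gam b agree
   up to o(a + gam b).  As 1 + gam H is positive definite on T, this gives
   a = D (a + gam b) + o(a + gam b) for a matrix D: the proximal map is strictly
   differentiable.  It remains to compose the two proximal steps. *)

(** The remainder must be small against [z k.+1 - z k], which can be far smaller than the distance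
    of [z k] to the limit. Differentiability of the proximal maps at the limit would only give a
    remainder relative to that distance; hence every local estimate compares two moving points. No
    inverse function theorem is applied to the proximal map: the graph of the subdifferential is
    linearized directly, [x + gam u] being the argument of the prox whose value is [x]. The
    multipliers depend on the pair [(x, u)], and their increments are of the same order as those of
    [u]. So the subgradients control only the tangential part of an increment; its normal part is
    controlled by the constraint. Estimates use the sup norm; the factors [n%:R] come from bounding
    the inner product by it. *)

(** * Inner product, sup norm and compactness in Euclidean space *)

Section EuclideanSpace.
Context {K : realType}.

Lemma dotpC n (u v : 'cV[K]_n) : dotp u v = dotp v u.
Proof. by apply: eq_bigr => i _; rewrite mulrC. Qed.

Lemma dotpDl n (u v w : 'cV[K]_n) : dotp (u + v) w = dotp u w + dotp v w.
Proof. by rewrite -big_split; apply: eq_bigr => i _; rewrite mxE mulrDl. Qed.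

Lemma dotpZl n a (u v : 'cV[K]_n) : dotp (a *: u) v = a * dotp u v.
Proof. by rewrite big_distrr; apply: eq_bigr => i _; rewrite mxE /= mulrA. Qed.

Lemma dotpNl n (u v : 'cV[K]_n) : dotp (- u) v = - dotp u v.
Proof. by rewrite -scaleN1r dotpZl mulN1r. Qed.

Lemma dotpDr n (u v w : 'cV[K]_n) : dotp w (u + v) = dotp w u + dotp w v.
Proof. by rewrite dotpC dotpDl !(dotpC w). Qed.

Lemma dotpZr n a (u v : 'cV[K]_n) : dotp u (a *: v) = a * dotp u v.
Proof. by rewrite dotpC dotpZl dotpC. Qed.

Lemma dotpNr n (u v : 'cV[K]_n) : dotp u (- v) = - dotp u v.
Proof. by rewrite dotpC dotpNl dotpC. Qed.

Definition dotpE := (dotpDl, dotpDr, dotpNl, dotpNr, dotpZl, dotpZr).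

Lemma dotp0l n (u : 'cV[K]_n) : dotp 0 u = 0.
Proof. by rewrite -(scale0r 0) dotpZl mul0r. Qed.

Lemma dotp0r n (u : 'cV[K]_n) : dotp u 0 = 0.
Proof. by rewrite dotpC dotp0l. Qed.

Lemma dotp_mxE n (u v : 'cV[K]_n) : dotp u v = (u^T *m v) 0 0.
Proof. by rewrite mxE; apply: eq_bigr => i _; rewrite mxE. Qed.

Lemma dotp_mulmxl n m (A : 'M[K]_(m, n)) u v :
  dotp (A *m u) v = dotp u (A^T *m v).
Proof. by rewrite !dotp_mxE trmx_mul mulmxA. Qed.

Lemma dotp_mulmxr n m (A : 'M[K]_(m, n)) u v :
  dotp u (A *m v) = dotp (A^T *m u) v.
Proof. by rewrite dotp_mulmxl trmxK. Qed.

Lemma dotp_ge0 n (u : 'cV[K]_n) : 0 <= dotp u u.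
Proof. by apply: sumr_ge0 => i _; rewrite -expr2 sqr_ge0. Qed.

Lemma dotp_eq0 n (u : 'cV[K]_n) : dotp u u = 0 -> u = 0.
Proof.
move/eqP; rewrite psumr_eq0 => [/allP h|i _]; last by rewrite -expr2 sqr_ge0.
apply/colP => i; rewrite mxE.
by have := h i (mem_index_enum i); rewrite /= mulf_eq0 orbb => /eqP.
Qed.

Lemma enorm_ge0 n (u : 'cV[K]_n) : 0 <= enorm u.
Proof. exact: sqrtr_ge0. Qed.

Lemma enorm_sqr n (u : 'cV[K]_n) : enorm u ^+ 2 = dotp u u.
Proof. by rewrite sqr_sqrtr // dotp_ge0. Qed.

Lemma enormZ n a (u : 'cV[K]_n) : enorm (a *: u) = `|a| * enorm u.
Proof.
by rewrite /enorm !dotpE mulrA -expr2 sqrtrM ?sqr_ge0// sqrtr_sqr.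
Qed.

Lemma enorm_eq0 n (u : 'cV[K]_n) : enorm u = 0 -> u = 0.
Proof. by move=> u0; apply: dotp_eq0; rewrite -enorm_sqr u0 expr0n. Qed.

Lemma cauchy_schwarz n (u v : 'cV[K]_n) : `|dotp u v| <= enorm u * enorm v.
Proof.
have [->|v0] := eqVneq v 0.
  by rewrite dotp0r normr0 mulr_ge0// enorm_ge0.
have vv : 0 < dotp v v.
  by rewrite lt_neqAle dotp_ge0 andbT eq_sym; apply: contra_neq v0 => /dotp_eq0.
rewrite -(@ler_pXn2r _ 2)// ?nnegrE// ?mulr_ge0 ?enorm_ge0//.
rewrite exprMn !enorm_sqr real_normK ?num_real//.
(* This square is [dotp v v] times the difference of the two sides of the squared inequality. *)
have := dotp_ge0 (dotp v v *: u - dotp u v *: v).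
rewrite !dotpE [dotp v u]dotpC => h.
rewrite -(ler_pM2r vv) -subr_ge0; apply: le_trans h _.
by rewrite le_eqVlt; apply/orP; left; apply/eqP; ring.
Qed.

(** For [n = 0] the right-hand side holds for every [a], hence the sign condition. *)
Lemma cv_norm_le n (u : 'cV[K]_n) a : 0 <= a ->
  (`|u| <= a) <-> (forall i, `|u i 0| <= a).
Proof.
move=> a0; rewrite [leLHS]mx_normrE; split => [/bigmax_leP[_ h] i|h].
  by have := h (i, 0) isT.
by apply/bigmax_leP; split => // -[i j] _ /=; rewrite ord1.
Qed.

Lemma cv_norm_coord n (u : 'cV[K]_n) i : `|u i 0| <= `|u|.
Proof. exact: (proj1 (cv_norm_le u (normr_ge0 u)) (lexx _) i). Qed.

Lemma norm_trmx n (u : 'cV[K]_n) : `|u^T| = `|u|.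
Proof.
apply/eqP; rewrite eq_le; apply/andP; split.
  rewrite [leLHS]mx_normrE; apply/bigmax_leP; split => [|-[i j] _]//=.
  by rewrite mxE ord1 cv_norm_coord.
apply/cv_norm_le => // i.
rewrite [leRHS]mx_normrE.
by rewrite (le_trans _ (le_bigmax _ _ (0, i)))//= mxE.
Qed.

Lemma dotp_norm_le n (u v : 'cV[K]_n) : `|dotp u v| <= n%:R * `|u| * `|v|.
Proof.
rewrite (le_trans (ler_norm_sum _ _ _))//.
rewrite (le_trans (ler_sum _ (G := fun=> `|u| * `|v|) _)) => // [i _|].
  by rewrite normrM ler_pM// cv_norm_coord.
by rewrite sumr_const card_ord -[leLHS]mulr_natl mulrA.
Qed.

Lemma norm_le_enorm n (u : 'cV[K]_n) : `|u| <= enorm u.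
Proof.
apply/cv_norm_le => [|i]; first exact: enorm_ge0.
rewrite -sqrtr_sqr ler_wsqrtr// /dotp (bigD1 i)//= expr2 lerDl.
by apply: sumr_ge0 => j _; rewrite -expr2 sqr_ge0.
Qed.

Lemma sqr_norm_le_dotp n (u : 'cV[K]_n) : `|u| ^+ 2 <= dotp u u.
Proof. by rewrite -enorm_sqr ler_pXn2r ?nnegrE ?norm_le_enorm ?enorm_ge0. Qed.

Lemma mulmx_norm_bound n m (A : 'M[K]_(m, n)) :
  exists2 C : K, 0 < C & forall v : 'cV[K]_n, `|A *m v| <= C * `|v|.
Proof.
exists (1 + n%:R * `|A|) => [|v].
  by rewrite ltr_wpDr// mulr_ge0.
apply/cv_norm_le => [|i]; first by rewrite mulr_ge0// addr_ge0// mulr_ge0.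
rewrite mxE (le_trans (ler_norm_sum _ _ _))//.
rewrite (le_trans (ler_sum _ (G := fun=> `|A| * `|v|) _)) => // [j _|].
  rewrite normrM ler_pM// ?cv_norm_coord// [leRHS]mx_normrE.
  by rewrite (le_trans _ (le_bigmax _ _ (i, j))).
by rewrite sumr_const card_ord -[leLHS]mulr_natl mulrA ler_wpM2r// lerDr.
Qed.

Lemma cv_bolzano_weierstrass n (u : nat -> 'cV[K]_n) (M : K) :
  (forall k, `|u k| <= M) ->
  exists l, forall e, 0 < e -> forall N, exists2 k, (N <= k)%N & `|u k - l| < e.
Proof.
move=> uM.
have cB : compact [set v : 'rV[K]_n | `|v| <= M].
  apply: bounded_closed_compact.
    by exists M; split; [exact: num_real|] => r Mr v /= /le_trans; apply; exact: ltW.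
  rewrite (_ : [set _ | _] = Num.norm @^-1` [set r | r <= M])//.
  by apply: closed_comp; [move=> ? _; exact: norm_continuous|exact: closed_le].
have [|l [_ cl]] := cB ((fun k => (u k)^T) @ \oo) _.
  by exists 0%N => // k _ /=; rewrite norm_trmx.
exists l^T => e e0 N.
have [|v [[k /= Nk <-]]] :=
    cl [set (u k)^T | k in [set k | (N <= k)%N]] (ball l e) _ (nbhsx_ballx _ _ e0).
  by exists N => // k /= Nk; exists k.
rewrite -ball_normE/= distrC -{1}(trmxK l) -linearB norm_trmx => h.
by exists k.
Qed.

Lemma nbhs_cvP n (x : 'cV[K]_n) (A : set 'cV[K]_n) :
  nbhs x A <-> exists2 e : K, 0 < e & forall y, `|y - x| < e -> A y.
Proof.
split=> [/nbhs_ballP[e /= e0 eA]|[e e0 eA]].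
  by exists e => // y yx; apply: eA; rewrite -ball_normE /= distrC.
apply/nbhs_ballP; exists e => //= y; rewrite -ball_normE /= distrC.
exact: eA.
Qed.

End EuclideanSpace.

(** * Subdifferentials, conjugates and proximal points *)

Section Subdifferential.
Context {K : realType}.

Lemma dotp_cvg n T (F : set_system T) (FF : Filter F)
    (f g : T -> 'cV[K]_n) a b :
  f @ F --> a -> g @ F --> b -> dotp (f x) (g x) @[x --> F] --> dotp a b.
Proof.
move=> fa gb; apply: cvg_big => [|i _].
  by move=> [p q]; exact: add_continuous.
have coord (h : T -> 'cV[K]_n) (c : 'cV[K]_n) : h @ F --> c -> h x i 0 @[x --> F] --> c i 0.
  by move=> hc; exact: (cvg_comp _ _ hc (@coord_continuous _ _ _ i 0 c)).
exact: cvgM (coord _ _ fa) (coord _ _ gb).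
Qed.

Lemma subdiff_fin_num n (f : 'cV[K]_n -> \bar K) x u :
  proper f -> subdiff f x u -> f x \is a fin_num.
Proof.
move=> [fN [y fy]] /(_ y) fxu; rewrite fin_numE fN/=.
by apply: contraTneq fxu => ->; rewrite addye// -ltNge.
Qed.

Lemma subdiff_le n (f : 'cV[K]_n -> \bar K) x u y a b :
  subdiff f x u -> f x = a%:E -> f y = b%:E -> a + dotp u (y - x) <= b.
Proof. by move=> /(_ y) + fx fy; rewrite fx fy -EFinD lee_fin. Qed.

Lemma subdiff_monotone n (f : 'cV[K]_n -> \bar K) x u y v :
  proper f -> subdiff f x u -> subdiff f y v -> 0 <= dotp (u - v) (x - y).
Proof.
move=> pf fxu fyv.
have [/fineK/esym fx /fineK/esym fy] := (subdiff_fin_num pf fxu, subdiff_fin_num pf fyv).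
have := subdiff_le fxu fx fy; have := subdiff_le fyv fy fx.
by rewrite !dotpE; lra.
Qed.

(** If the subgradient inequality failed at [y] for the limit pair, lower semicontinuity at [x] and
    continuity of the inner product would make it fail for nearby pairs of the graph. *)
Lemma subdiff_closed n (f : 'cV[K]_n -> \bar K) :
  proper f -> lower_semicontinuous f ->
  closed [set p : 'cV[K]_n * 'cV[K]_n | subdiff f p.1 p.2].
Proof.
move=> pf lf [x u] clxu y; rewrite leNgt; apply/negP => fyx.
have yN : f y != -oo%E by have [+ _] := pf; exact.
have /fineK/esym fyE : f y \is a fin_num.
  by rewrite fin_numE yN/=; apply: contraTneq fyx => ->; rewrite ltNge leey.
set b := fine (f y) in fyE.
have bfx : ((b - dotp u (y - x))%:E < f x)%E.
  by rewrite EFinB lteBlDr// -fyE.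
have [a ba afx] : exists2 a : K, b - dotp u (y - x) < a & (a%:E < f x)%E.
  move: (f x) bfx => [r||]//=.
  - rewrite lte_fin => h; exists ((b - dotp u (y - x) + r) / 2); rewrite ?lte_fin; lra.
  - by exists (b - dotp u (y - x) + 1); rewrite ?ltry//; lra.
have [V Vx fV] := lf _ _ afx.
have cvd : (b - dotp p.2 (y - p.1)) @[p --> (x, u)] --> b - dotp u (y - x).
  apply: cvgB; first exact: cvg_cst.
  apply: dotp_cvg; first exact: cvg_snd.
  by apply: cvgB; [exact: cvg_cst|exact: cvg_fst].
have nV : \forall p \near (x, u), V p.1 by apply: cvg_fst.
have nd : \forall p \near (x, u), b - dotp p.2 (y - p.1) < a.
  exact: (cvgr_lt _ cvd).
have [[x' u'] [/= fx'u' [Vx' da]]] := clxu _ (filterI nV nd).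
have /fineK/esym fx'E := subdiff_fin_num pf fx'u'.
have := fV _ Vx'; rewrite fx'E lte_fin => afx'.
by have := subdiff_le fx'u' fx'E fyE; move: da => /=; lra.
Qed.

(** Minimality is tested at [x + t (y - x)], where convexity bounds [f]; the inequality is divided
    by [t], and [t] tends to 0. *)
Lemma prox_subdiff n (f : 'cV[K]_n -> \bar K) (g : K) w x :
  proper f -> convex f -> 0 < g ->
  prox (fun y => g%:E * f y)%E w x -> subdiff f x (g^-1 *: (w - x)).
Proof.
move=> [fN [y0 fy0]] cf g0 px.
have fin y : (f y < +oo)%E -> f y = (fine (f y))%:E.
  by move=> fy; rewrite fineK// fin_numE fN/= lt_eqF.
have fx : f x = (fine (f x))%:E.
  apply: (fin x); rewrite ltey; apply/eqP => fxy.
  have := px y0; rewrite fxy gt0_muley ?lte_fin// addye// leye_eq.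
  by rewrite (fin _ fy0) -EFinM -EFinD.
set a := fine (f x) in fx; move=> y.
have [fy|] := boolP (f y < +oo)%E; last first.
  by rewrite lt_neqAle leey andbT negbK => /eqP ->; rewrite leey.
rewrite (fin y fy) fx -EFinD lee_fin; set b := fine _.
pose P := dotp (x - w) (y - x); pose Q := dotp (y - x) (y - x).
have key (t : K) : 0 < t < 1 -> 0 <= g * (b - a) + P + t * (Q / 2).
  move=> t01; have t0 : 0 < t by case/andP: t01.
  have cfy := cf y x t t01; have := px (t *: y + (1 - t) *: x).
  have [fz|] := boolP (f (t *: y + (1 - t) *: x)%R < +oo)%E; last first.
    rewrite lt_neqAle leey andbT negbK => /eqP fz.
    by move: cfy; rewrite fz fx (fin _ fy) -!EFinM -EFinD leye_eq.
  move: cfy; rewrite (fin _ fz) fx (fin _ fy) -!EFinM -!EFinD !lee_fin -/b -/a.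
  set c := fine _; rewrite !enorm_sqr => cab.
  have -> : t *: y + (1 - t) *: x - w = (x - w) + t *: (y - x).
    by apply/colP => i; rewrite !mxE; ring.
  have gc : g * c <= g * (t * b + (1 - t) * a) by rewrite ler_pM2l.
  move: (x - w) (y - x) @P @Q => X Y /=.
  rewrite !dotpDl !dotpDr !dotpZl !dotpZr [dotp Y X]dotpC => h.
  by rewrite -(pmulr_rge0 _ t0); lra.
have lim : 0 <= g * (b - a) + P.
  rewrite leNgt; apply/negP => neg.
  pose c := - (g * (b - a) + P); have c0 : 0 < c by rewrite /c; lra.
  have Q0 : 0 <= Q by exact: dotp_ge0.
  have d0 : 0 < c + Q + 1 by lra.
  (* [t (c + Q + 1) = c] forces [t < 1] and [t Q < c], whereas [key] gives [c <= t Q / 2]. *)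
  pose t := c / (c + Q + 1).
  have t0 : 0 < t by rewrite divr_gt0.
  have tE : t * (c + Q + 1) = c by rewrite divfK// gt_eqF.
  have t1 : t < 1 by rewrite ltr_pdivrMr// mul1r; lra.
  have := key t; rewrite t0 t1 => /(_ isT).
  have := mulr_gt0 t0 c0; move: tE; rewrite !mulrDr mulr1 /c; lra.
rewrite dotpZl -(ler_pM2l g0) mulrDr mulrA divff ?gt_eqF// mul1r.
by move: lim; rewrite /P -[x - w]opprB dotpNl; lra.
Qed.

Lemma fenchel_young n (f : 'cV[K]_n -> \bar K) u x :
  ((dotp u x)%:E - f x <= fenchel f u)%E.
Proof. by apply: ereal_sup_ubound; exists x. Qed.

Lemma fenchel_subdiffE n (f : 'cV[K]_n -> \bar K) u x a :
  f x = a%:E -> subdiff f x u -> fenchel f u = (dotp u x - a)%:E.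
Proof.
move=> fx fxu; apply/eqP; rewrite eq_le; apply/andP; split; last first.
  by rewrite EFinB -fx; exact: fenchel_young.
apply: ge_ereal_sup => _ [y _ <-].
have := fxu y; rewrite fx -EFinD; case: (f y) => [b| |]//.
  by rewrite -EFinB !lee_fin !dotpE; lra.
by rewrite addeNy leNye.
Qed.

Lemma subdiff_fenchel n (f : 'cV[K]_n -> \bar K) u x :
  proper f -> subdiff f x u -> subdiff (fenchel f) u x.
Proof.
move=> pf fxu; have /fineK/esym fx := subdiff_fin_num pf fxu.
move=> v; rewrite (fenchel_subdiffE fx fxu) -EFinD.
have -> : dotp u x - fine (f x) + dotp x (v - u) = dotp v x - fine (f x).
  by rewrite !dotpE !(dotpC x); ring.
by rewrite EFinB -fx; exact: fenchel_young.
Qed.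

Lemma fenchel_proper n (f : 'cV[K]_n -> \bar K) u x :
  proper f -> subdiff f x u -> proper (fenchel f).
Proof.
move=> pf fxu; have /fineK/esym fx := subdiff_fin_num pf fxu; split => [v|].
  by rewrite -ltNye (lt_le_trans _ (fenchel_young f v x))// fx -EFinB ltNyr.
by exists u; rewrite (fenchel_subdiffE fx fxu) ltry.
Qed.

Lemma fenchel_convex n (f : 'cV[K]_n -> \bar K) : proper f -> convex (fenchel f).
Proof.
move=> [fN _] u v t /andP[t0 t1]; apply: ge_ereal_sup => _ [y _ <-].
have := fN y; have := fenchel_young f u y; have := fenchel_young f v y.
case: (f y) => [b| |]// hv hu _; last by rewrite addeNy leNye.
rewrite dotpDl !dotpZl.
have -> : ((t * dotp u y + (1 - t) * dotp v y)%:E - b%:E =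
  t%:E * ((dotp u y)%:E - b%:E) + (1 - t)%:E * ((dotp v y)%:E - b%:E))%E.
  by rewrite -!EFinB -!EFinM -EFinD; congr (_%:E); ring.
by apply: leeD; rewrite lee_wpmul2l// lee_fin; lra.
Qed.

(** The direct method: the subgradient gives an affine minorant of [f], so [f + q] is coercive and a
    minimizing sequence has a cluster point. *)
Lemma prox_nonempty n (f : 'cV[K]_n -> \bar K) x0 u0 w :
  proper f -> lower_semicontinuous f -> subdiff f x0 u0 -> prox f w !=set0.
Proof.
move=> pf lf fxu; have /fineK/esym fx0 := subdiff_fin_num pf fxu.
have fN := pf.1; set a := fine _ in fx0.
pose q y := 2^-1 * enorm (y - w) ^+ 2.
pose S := [set r : K | exists y, (f y + (q y)%:E = r%:E)%E].
(* With [Y = y - w], completing a square gives [<u0, Y> >= - |Y|^2 / 4 - |u0|^2]; a quarter of the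
   squared distance remains. *)
pose c := a + dotp u0 (w - x0) - dotp u0 u0.
have Slb y r : (f y + (q y)%:E = r%:E)%E -> c + 4^-1 * dotp (y - w) (y - w) <= r.
  have := fxu y; rewrite fx0 -EFinD; case: (f y) => [b| |]//.
  rewrite lee_fin -EFinD => h [<-]; rewrite /q enorm_sqr /c.
  have := dotp_ge0 (2^-1 *: (y - w) + u0).
  move: h; have -> : y - x0 = (y - w) + (w - x0) by rewrite addrA subrK.
  move: (y - w) (w - x0) => Y Z.
  rewrite !dotpDr !dotpDl !dotpZl !dotpZr [dotp Y u0]dotpC; lra.
have hS : has_inf S.
  split; first by exists (a + q x0), x0; rewrite fx0.
  by exists c => r [y /Slb]; have := dotp_ge0 (y - w); lra.
pose m := inf S.
have /choice[y yP] : forall k : nat, exists y : 'cV[K]_n,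
    exists2 r : K, (f y + (q y)%:E = r%:E)%E & r < m + k.+1%:R^-1.
  move=> k; have [|r [y yr] rm] := @inf_adherent _ S k.+1%:R^-1 _ hS; first by rewrite invr_gt0.
  by exists y, r.
have [k|l lP] := @cv_bolzano_weierstrass _ _ y (`|w| + (1 + 4 * (m + 1 - c))).
  have [r /Slb h rm] := yP k.
  have k1 : k.+1%:R^-1 <= 1 :> K by rewrite invf_le1// ler1n.
  have := sqr_norm_le_dotp (y k - w).
  have := ler_normD w (y k - w); rewrite addrC subrK => h1 h2.
  apply: le_trans h1 _; rewrite lerD2l.
  have sqr (d : K) : d <= d ^+ 2 + 1 by have := sqr_ge0 (d - 2^-1); rewrite sqrrB; lra.
  apply: le_trans (sqr _) _.
  by move: h2 h k1 rm; move: (`|_| ^+ 2) (dotp _ _) (k.+1%:R^-1) => *; lra.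
exists l => z; rewrite -/(q l) -/(q z).
have ml : (f l + (q l)%:E <= m%:E)%E.
  rewrite leNgt; apply/negP => ml.
  have [b mb bfl] : exists2 b : K, m - q l < b & (b%:E < f l)%E.
    move: (f l) ml (fN l) => [r||]// ml _.
    - move: ml; rewrite -EFinD lte_fin => ml.
      by exists ((m - q l + r) / 2); rewrite ?lte_fin; lra.
    - by exists (m - q l + 1); rewrite ?ltry//; lra.
  have [V Vl fV] := lf _ _ bfl.
  (* Half of the gap [d] absorbs the variation of [q] near [l], the other half the error
     [1 / (k + 1)] of the minimizing sequence. *)
  pose d := b - (m - q l); have d0 : 0 < d by rewrite /d; lra.
  have dq : dotp (z - w) (z - w) @[z --> l] --> dotp (l - w) (l - w).
    have sw : z - w @[z --> l] --> l - w.
      by apply: (@cvgB _ _ _ (nbhs l) _ id (fun=> w)); [exact: cvg_id|exact: cvg_cst].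
    exact: (@dotp_cvg _ _ (nbhs l) _ _ _ _ _ sw sw).
  have cq : q z @[z --> l] --> q l.
    rewrite /q enorm_sqr; under eq_fun do rewrite enorm_sqr.
    exact: cvgM (cvg_cst _) dq.
  have nq : \forall z \near l, q l - d / 2 < q z.
    by apply: (cvgr_gt _ cq); lra.
  have /nbhs_cvP[e e0 eP] : \forall z \near l, V z /\ q l - d / 2 < q z.
    exact: (@filterI _ (nbhs l)).
  have [N _ NP] : \forall k \near \oo, k.+1%:R^-1 < d / 2.
    by apply: (near_infty_natSinv_lt (PosNum (divr_gt0 d0 (ltr0Sn K 1)))).
  have [k Nk lk] := lP e e0 N.
  have [/fV + qk] := eP (y k) lk.
  have [r + rm] := yP k; case: (f (y k)) => [s| |]//.
  rewrite -EFinD lte_fin => -[sr] bs; 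
  move: (NP k Nk) rm qk sr bs; rewrite /d /=; move: (k.+1%:R^-1) => i; lra.
apply: le_trans ml _.
have [fz|] := boolP (f z + (q z)%:E < +oo)%E; last first.
  by rewrite lt_neqAle leey andbT negbK => /eqP ->; rewrite leey.
have : (f z + (q z)%:E)%E \is a fin_num.
  rewrite fin_numE (lt_eqF fz) andbT; have := fN z.
  by case: (f z).
move/fineK => fzE; rewrite -fzE lee_fin; apply: ge_inf; first exact: hS.2.
by exists z; rewrite fzE.
Qed.

(* Fenchel-Moreau without separation: p = prox_f (x + u) has x + u - p in df p,
   and monotonicity of the subdifferential of f* forces p = x. *)
Lemma subdiff_fenchel_inv n (f : 'cV[K]_n -> \bar K) x0 u0 u x :
  proper_convex_lsc f -> subdiff f x0 u0 ->
  subdiff (fenchel f) u x -> subdiff f x u.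
Proof.
move=> [pf cf lf] f0 fux; have [p pP] := prox_nonempty (x + u) pf lf f0.
have fp : subdiff f p (x + u - p).
  rewrite -[X in subdiff _ _ X]scale1r -{1}[1]invr1.
  apply: prox_subdiff => //; move: pP; congr (prox _ _ _).
  by apply/funext => y; rewrite mul1e.
have := subdiff_monotone (fenchel_proper pf f0) fux (subdiff_fenchel pf fp).
have -> : u - (x + u - p) = - (x - p) by apply/matrixP => i j; rewrite !mxE; ring.
rewrite dotpNr oppr_ge0 => le0.
have /dotp_eq0/eqP : dotp (x - p) (x - p) = 0.
  by apply/eqP; rewrite eq_le le0 dotp_ge0.
by rewrite subr_eq0 => /eqP xp; move: fp; rewrite -xp addrAC subrr add0r.
Qed.

End Subdifferential.

(** * The primal-dual metric and saddle points *)

Section PrimalDualConvergence.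
Context {K : realType}.

(** [opnorm] is a [sup], which dominates its set only once that set is known to be bounded. *)
Lemma opnorm_has_ubound n m (L : 'M[K]_(m, n)) :
  has_ubound [set enorm (L *m x) | x in [set x | enorm x <= 1]].
Proof.
have [C C0 LC] := mulmx_norm_bound L.
exists (m%:R * C ^+ 2 + 1) => _ [y /= y1 <-].
have yn : `|y| <= 1 := le_trans (norm_le_enorm y) y1.
have Ly : `|L *m y| <= C by rewrite (le_trans (LC y))// ler_piMr// ltW.
have : enorm (L *m y) ^+ 2 <= m%:R * C ^+ 2.
  rewrite enorm_sqr (le_trans (ler_norm _))// (le_trans (dotp_norm_le _ _))//.
  by rewrite -mulrA ler_wpM2l// expr2 ler_pM.
have := sqr_ge0 (enorm (L *m y) - 2^-1); rewrite sqrrB.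
move: (m%:R * _) (enorm _) => p q; lra.
Qed.

Lemma enorm_mulmx_le n m (L : 'M[K]_(m, n)) x :
  enorm (L *m x) <= opnorm L * enorm x.
Proof.
have [->|x0] := eqVneq x 0.
  by rewrite mulmx0 /enorm !dotp0l sqrtr0 mulr0.
have e0 : 0 < enorm x.
  by rewrite lt_neqAle enorm_ge0 andbT eq_sym; apply: contra_neq x0 => /enorm_eq0.
rewrite -ler_pdivrMr//; have : enorm (L *m ((enorm x)^-1 *: x)) <= opnorm L.
  apply: ub_le_sup; first exact: opnorm_has_ubound.
  exists ((enorm x)^-1 *: x) => //=.
  by rewrite enormZ ger0_norm ?invr_ge0 ?enorm_ge0// mulVf ?gt_eqF.
by rewrite -scalemxAr enormZ ger0_norm ?invr_ge0 ?enorm_ge0// mulrC.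
Qed.

(* squared norm of (a, b) for the metric [[1 / gR, - L^T], [- L, 1 / gJ]], in
   which the primal-dual iteration is a proximal point iteration *)
Definition pd_form n m (L : 'M[K]_(m, n)) (gR gJ : K) a b :=
  gR^-1 * dotp a a - 2 * dotp (L *m a) b + gJ^-1 * dotp b b.

(** With [r = 1 / gR], [j = 1 / gJ], [l = opnorm L], the constant is determinant over trace of
    [[[r, - l], [- l, j]]]. Subtracting it from the diagonal leaves the determinant [c ^+ 2] and a
    positive corner [r - c], so the form stays nonnegative. *)
Lemma pd_form_lower n m (L : 'M[K]_(m, n)) (gR gJ : K) :
  0 < gR -> 0 < gJ -> gR * gJ * opnorm L ^+ 2 < 1 ->
  exists2 c : K, 0 < c &
    forall a b, c * (`|a| ^+ 2 + `|b| ^+ 2) <= pd_form L gR gJ a b.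
Proof.
move=> gR0 gJ0 step; rewrite /pd_form.
have r0 : 0 < gR^-1 by rewrite invr_gt0.
have j0 : 0 < gJ^-1 by rewrite invr_gt0.
set r := gR^-1 in r0 *; set j := gJ^-1 in j0 *.
have rj0 : 0 < r * j by rewrite mulr_gt0.
set l := opnorm L in step *.
have lrj : l ^+ 2 < r * j.
  move: step; rewrite -(ltr_pM2l rj0) mulr1; congr (_ < _).
  by rewrite /r /j; field; rewrite !gt_eqF.
have s0 : 0 < r + j by rewrite addr_gt0.
pose c := (r * j - l ^+ 2) / (r + j).
have cE : c * (r + j) = r * j - l ^+ 2 by rewrite divfK// gt_eqF.
have c0 : 0 < c by rewrite divr_gt0// subr_gt0.
have l2 := sqr_ge0 l.
have cr : c < r by rewrite ltr_pdivrMr// mulrDr; have := mulr_gt0 r0 r0; lra.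
exists c => // a b.
have := cauchy_schwarz (L *m a) b.
have := ler_wpM2r (enorm_ge0 b) (enorm_mulmx_le L a); rewrite -/l.
have := sqr_norm_le_dotp a; have := sqr_norm_le_dotp b.
rewrite -!enorm_sqr; set A := enorm a; set B := enorm b => hb ha hL hCS.
have {hL}hCS : dotp (L *m a) b <= l * A * B.
  exact: le_trans (ler_norm _) (le_trans hCS hL).
have := ler_wpM2l (ltW c0) ha; have := ler_wpM2l (ltW c0) hb.
have q : 0 <= (r - c) * A ^+ 2 - 2 * (l * A * B) + (j - c) * B ^+ 2.
  have rc0 : 0 < r - c by rewrite subr_gt0.
  rewrite -(pmulr_rge0 _ rc0).
  have -> : (r - c) * ((r - c) * A ^+ 2 - 2 * (l * A * B) + (j - c) * B ^+ 2) =
    ((r - c) * A - l * B) ^+ 2 +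
    (r * j - c * (r + j) + c ^+ 2 - l ^+ 2) * B ^+ 2 by ring.
  rewrite cE addr_ge0 ?sqr_ge0// mulr_ge0 ?sqr_ge0//.
  by have := sqr_ge0 c; lra.
by lra.
Qed.

Lemma pd_form_upper n m (L : 'M[K]_(m, n)) (gR gJ : K) :
  0 < gR -> 0 < gJ -> exists2 D : K, 0 < D &
    forall a b e, `|a| <= e -> `|b| <= e -> pd_form L gR gJ a b <= D * e ^+ 2.
Proof.
move=> gR0 gJ0; have [C C0 LC] := mulmx_norm_bound L.
have r0 : 0 < gR^-1 by rewrite invr_gt0.
have j0 : 0 < gJ^-1 by rewrite invr_gt0.
rewrite /pd_form; move: (gR^-1) (gJ^-1) r0 j0 => r j r0 j0.
exists (1 + r * n%:R + 2 * (m%:R * C) + j * m%:R) => [|a b e ae be].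
  have rn := mulr_ge0 (ltW r0) (ler0n K n); have jm := mulr_ge0 (ltW j0) (ler0n K m).
  by have := mulr_ge0 (ler0n K m) (ltW C0); lra.
have e0 : 0 <= e := le_trans (normr_ge0 a) ae.
have dab p (u v : 'cV[K]_p) s t : `|u| <= s -> `|v| <= t ->
    `|dotp u v| <= p%:R * (s * t).
  move=> us vt; rewrite (le_trans (dotp_norm_le _ _))// -mulrA ler_wpM2l//.
  exact: ler_pM.
have Lae : `|L *m a| <= C * e by rewrite (le_trans (LC a))// ler_wpM2l// ltW.
have := dab _ _ _ _ _ ae ae => /ler_normlW/(ler_wpM2l (ltW r0)).
have := dab _ _ _ _ _ be be => /ler_normlW/(ler_wpM2l (ltW j0)).
have := dab _ _ _ _ _ Lae be; rewrite -normrN => /ler_normlW.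
have := sqr_ge0 e; move: (n%:R) (m%:R) => N M; lra.
Qed.

(** Monotonicity between the new point [z'] and the saddle point [zs] says that [z - z'] and
    [z' - zs] have a nonnegative inner product in the metric, the skew terms in [L] cancelling; then
    expand the square of their sum. The full extrapolation [x' + (x' - x)] is what makes the metric
    symmetric. *)
Lemma pd_form_fejer n m (L : 'M[K]_(m, n)) (gR gJ : K)
    (f : 'cV[K]_n -> \bar K) (h : 'cV[K]_m -> \bar K) x x' w w' xs ws :
  proper f -> proper h ->
  subdiff f x' (gR^-1 *: (x - gR *: (L^T *m w) - x')) ->
  subdiff h w' (gJ^-1 *: (w + gJ *: (L *m (x' + (x' - x))) - w')) ->
  subdiff f xs (- (L^T *m ws)) -> subdiff h ws (L *m xs) ->
  0 < gR -> 0 < gJ ->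
  pd_form L gR gJ (x' - xs) (w' - ws) + pd_form L gR gJ (x - x') (w - w') <=
  pd_form L gR gJ (x - xs) (w - ws).
Proof.
move=> pf ph fx hw fxs hws gR0 gJ0.
have := subdiff_monotone pf fx fxs; have := subdiff_monotone ph hw hws.
have -> : gR^-1 *: (x - gR *: (L^T *m w) - x') - - (L^T *m ws) =
    gR^-1 *: (x - x') - L^T *m (w - w') - L^T *m (w' - ws).
  rewrite !mulmxBr; move: (L^T *m _) (L^T *m _) (L^T *m _) => p q s.
  by apply/matrixP => i k; rewrite !mxE; field; rewrite gt_eqF.
have -> : gJ^-1 *: (w + gJ *: (L *m (x' + (x' - x))) - w') - L *m xs =
    gJ^-1 *: (w - w') - L *m (x - x') + L *m (x' - xs).
  rewrite !(mulmxBr, mulmxDr); move: (L *m _) (L *m _) (L *m _) => p q s.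
  by apply/matrixP => i k; rewrite !mxE; field; rewrite gt_eqF.
have -> : x - xs = (x - x') + (x' - xs) by rewrite addrA subrK.
have -> : w - ws = (w - w') + (w' - ws) by rewrite addrA subrK.
move: (x - x') (x' - xs) (w - w') (w' - ws) => a' a b' b.
rewrite /pd_form !mulmxDr !dotpE.
rewrite !dotp_mulmxl !trmxK [dotp a a']dotpC [dotp b b']dotpC.
rewrite [dotp b' (L *m a)]dotpC [dotp b (L *m a)]dotpC !dotp_mulmxl.
by move: (gR^-1) (gJ^-1) => r j; lra.
Qed.

(** Adding the two subgradient inequalities cancels the coupling terms; the dual half is weak
    duality, with Fenchel-Young equalities at the saddle point. *)
Lemma pd_optimality n m (R : 'cV[K]_n -> \bar K) (J : 'cV[K]_m -> \bar K)
    (L : 'M[K]_(m, n)) xs ws :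
  proper R -> proper J ->
  subdiff R xs (- (L^T *m ws)) -> subdiff J (L *m xs) ws ->
  primal_sol R J L xs /\ dual_sol R J L ws.
Proof.
move=> pR pJ Rxs Jxs.
have /fineK/esym Rx := subdiff_fin_num pR Rxs; set r := fine _ in Rx.
have /fineK/esym Jx := subdiff_fin_num pJ Jxs; set j := fine _ in Jx.
split=> [y|w].
  have := leeD (Rxs y) (Jxs (L *m y)); apply: le_trans.
  rewrite Rx Jx -!EFinD lee_fin -mulmxBr dotpNl dotp_mulmxl trmxK.
  lra.
rewrite (fenchel_subdiffE Rx Rxs) (fenchel_subdiffE Jx Jxs).
have := leeD (fenchel_young R (- (L^T *m w)) xs) (fenchel_young J w (L *m xs)).
apply: le_trans; rewrite Rx Jx -!EFinB -!EFinD lee_fin.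
rewrite !dotpNl !dotp_mulmxl !trmxK; lra.
Qed.

Lemma subdiff_limit n (f : 'cV[K]_n -> \bar K) x u :
  proper f -> lower_semicontinuous f ->
  (forall e : K, 0 < e ->
    exists x' u', [/\ subdiff f x' u', `|x' - x| < e & `|u' - u| < e]) ->
  subdiff f x u.
Proof.
move=> pf lf near_sub; apply: (subdiff_closed pf lf (t := (x, u))).
move=> B [[B1 B2] /= [/nbhs_cvP[e1 e10 B1P] /nbhs_cvP[e2 e20 B2P]] BP].
have [|x' [u' [fx' xx uu]]] := near_sub (Num.min e1 e2).
  by rewrite lt_min e10.
move: xx uu; rewrite !lt_min => /andP[xx _] /andP[_ uu].
by exists (x', u'); split => //; apply: BP; split; [exact: B1P|exact: B2P].
Qed.

Lemma norm_col_mx n m (a : 'cV[K]_n) (b : 'cV[K]_m) :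
  `|col_mx a b| = Num.max `|a| `|b|.
Proof.
apply/eqP; rewrite eq_le ge_max; apply/andP; split.
  apply/cv_norm_le => [|i]; first by rewrite le_max normr_ge0.
  case: (splitP i) => k ik.
    have -> : i = lshift m k by exact: val_inj.
    by rewrite col_mxEu le_max cv_norm_coord.
  have -> : i = rshift n k by exact: val_inj.
  by rewrite col_mxEd le_max cv_norm_coord orbT.
apply/andP; split; apply/cv_norm_le => // i.
  by rewrite -(col_mxEu a b) cv_norm_coord.
by rewrite -(col_mxEd a b) cv_norm_coord.
Qed.

End PrimalDualConvergence.

(** * Convergence of the iterates to a saddle point *)

Section PrimalDualLimit.
Context {K : realType} {n m : nat}.
Variables (R : 'cV[K]_n -> \bar K) (J : 'cV[K]_m -> \bar K) (L : 'M[K]_(m, n)).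
Variables (gR gJ : K) (x xbar : nat -> 'cV[K]_n) (w : nat -> 'cV[K]_m).
Hypotheses (HR : proper_convex_lsc R) (HJ : proper_convex_lsc J).
Hypothesis H0 : sv_ran (fun y : 'cV[K]_n =>
  [set u + L^T *m v | u in subdiff R y & v in subdiff J (L *m y)]) 0.
Hypotheses (HgR : 0 < gR) (HgJ : 0 < gJ).
Hypothesis Hiter : primal_dual_iteration R J L gR gJ 1 x xbar w.
Hypothesis Hstep : gR * gJ * opnorm L ^+ 2 < 1.

Lemma pd_start : exists y0 v0,
  subdiff R y0 (- (L^T *m v0)) /\ subdiff J (L *m y0) v0.
Proof.
have [y0 _ [u0 Ru [v0 Jv /eqP e]]] := H0.
by exists y0, v0; split=> //; move: e; rewrite addr_eq0 => /eqP <-.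
Qed.

Lemma pd_proper_fenchel : proper (fenchel J).
Proof.
have [y0 [v0 [_ Jv]]] := pd_start; have [pJ _ _] := HJ.
exact: fenchel_proper pJ Jv.
Qed.

Lemma pd_step_primal k :
  subdiff R (x k.+1) (gR^-1 *: (x k - gR *: (L^T *m w k) - x k.+1)).
Proof. by have [pR cR _] := HR; have [px _ _] := Hiter k; exact: prox_subdiff px. Qed.

Lemma pd_step_dual k :
  subdiff (fenchel J) (w k.+1)
    (gJ^-1 *: (w k + gJ *: (L *m (x k.+1 + (x k.+1 - x k))) - w k.+1)).
Proof.
have [pJ _ _] := HJ; have [_ xb pw] := Hiter k.
move: pw; rewrite xb scale1r => pw.
exact: prox_subdiff pd_proper_fenchel (fenchel_convex pJ) HgJ pw.
Qed.

Let V xs ws k := pd_form L gR gJ (x k - xs) (w k - ws).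

Lemma pd_form_ge0 a b : 0 <= pd_form L gR gJ a b.
Proof.
have [c c0 cP] := pd_form_lower HgR HgJ Hstep.
by apply: le_trans (cP a b); rewrite mulr_ge0 ?addr_ge0 ?sqr_ge0// ltW.
Qed.

Lemma pd_form_small e : 0 < e -> exists2 d : K, 0 < d &
  forall a b, pd_form L gR gJ a b < d -> `|a| < e /\ `|b| < e.
Proof.
move=> e0; have [c c0 cP] := pd_form_lower HgR HgJ Hstep.
exists (c * e ^+ 2) => [|a b ab]; first by rewrite mulr_gt0// exprn_gt0.
have := le_lt_trans (cP a b) ab; rewrite ltr_pM2l// => ab2.
have [a2 b2] : `|a| ^+ 2 < e ^+ 2 /\ `|b| ^+ 2 < e ^+ 2.
  by have := sqr_ge0 `|a|; have := sqr_ge0 `|b|; split; lra.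
by split; rewrite -(@ltr_pXn2r _ 2)// nnegrE// ltW.
Qed.

Lemma pd_lyapunov xs ws k :
  subdiff R xs (- (L^T *m ws)) -> subdiff J (L *m xs) ws ->
  V xs ws k.+1 + pd_form L gR gJ (x k - x k.+1) (w k - w k.+1) <= V xs ws k.
Proof.
move=> Rs Js; have [[pR _ _] [pJ _ _]] := (HR, HJ).
apply: (pd_form_fejer pR pd_proper_fenchel (pd_step_primal k) (pd_step_dual k)) => //.
exact: subdiff_fenchel.
Qed.

Lemma pd_lyapunov_mono xs ws k j :
  subdiff R xs (- (L^T *m ws)) -> subdiff J (L *m xs) ws ->
  (k <= j)%N -> V xs ws j <= V xs ws k.
Proof.
move=> Rs Js; elim: j => [|j ih]; first by rewrite leqn0 => /eqP ->.
rewrite leq_eqVlt => /predU1P[->//|]; rewrite ltnS => /ih; apply: le_trans.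
apply: le_trans (pd_lyapunov j Rs Js).
by rewrite lerDl pd_form_ge0.
Qed.

(** Each decrease of [V] dominates the squared step; once [V] is within [d] of its infimum, every
    later decrease is below [d]. *)
Lemma pd_differences e : 0 < e -> exists N, forall k, (N <= k)%N ->
  `|x k - x k.+1| < e /\ `|w k - w k.+1| < e.
Proof.
move=> e0; have [d d0 dP] := pd_form_small e0.
have [y0 [v0 [Rs Js]]] := pd_start.
have hS : has_inf (range (V y0 v0)).
  split; first by exists (V y0 v0 0%N), 0%N.
  by exists 0 => _ [k _ <-]; exact: pd_form_ge0.
have [_ [N _ <-] NP] := inf_adherent d0 hS.
exists N => k Nk; apply: dP.
have := pd_lyapunov k Rs Js; have := pd_lyapunov_mono Rs Js Nk.
have : inf (range (V y0 v0)) <= V y0 v0 k.+1 by apply: (ge_inf hS.2); exists k.+1.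
by move: (pd_form _ _ _ _ _) (inf _) NP => p q; lra.
Qed.

Lemma pd_cluster : exists xs ws, forall e, 0 < e -> forall N,
  exists2 k, (N <= k)%N & [/\ `|x k - xs| < e & `|w k - ws| < e].
Proof.
have [y0 [v0 [Rs Js]]] := pd_start.
have [c c0 cP] := pd_form_lower HgR HgJ Hstep.
pose M := V y0 v0 0%N / c + 1 + `|y0| + `|v0|.
have [k|l lP] := @cv_bolzano_weierstrass _ _ (fun k => col_mx (x k) (w k)) M.
  have := le_trans (cP _ _) (pd_lyapunov_mono Rs Js (leq0n k)).
  rewrite -ler_pdivlMl// => b.
  have sq (d : K) : d <= d ^+ 2 + 1 by have := sqr_ge0 (d - 2^-1); rewrite sqrrB; lra.
  have [sx sw] := (sqr_ge0 `|x k - y0|, sqr_ge0 `|w k - v0|).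
  have [qx qw] := (sq `|x k - y0|, sq `|w k - v0|).
  have := ler_normD (x k - y0) y0; have := ler_normD (w k - v0) v0.
  rewrite !subrK => hw hx; rewrite norm_col_mx ge_max /M mulrC.
  have [ny nv] := (normr_ge0 y0, normr_ge0 v0).
  by move: (c^-1 * _) b => q b; apply/andP; split; lra.
exists (usubmx l), (dsubmx l) => e e0 N; have [k Nk] := lP e e0 N.
rewrite -{1}(vsubmxK l) opp_col_mx add_col_mx norm_col_mx gt_max => /andP[? ?].
by exists k.
Qed.

Theorem pd_converges : exists xs ws,
  [/\ subdiff R xs (- (L^T *m ws)), subdiff J (L *m xs) ws,
      x @ \oo --> xs & w @ \oo --> ws].
Proof.
have [xs [ws cl]] := pd_cluster; exists xs, ws.
have [[pR cR lR] [pJ cJ lJ]] := (HR, HJ).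
have [y0 [v0 [R0 J0]]] := pd_start.
(* The cluster point is approached at indices at least [N.+1], so that each one has a predecessor
   with a small step. *)
have near e : 0 < e -> exists k, [/\ `|x k.+1 - xs| < e, `|w k.+1 - ws| < e,
    `|x k - x k.+1| < e & `|w k - w k.+1| < e].
  move=> e0; have [N NP] := pd_differences e0; have [[|k]//= Nk [xk wk]] := cl e e0 N.+1.
  by have [? ?] := NP k Nk; exists k.
have [C C0 LC] := mulmx_norm_bound L; have [C' C'0 LC'] := mulmx_norm_bound L^T.
have r0 : 0 < gR^-1 by rewrite invr_gt0.
have j0 : 0 < gJ^-1 by rewrite invr_gt0.
have tri p (a b : 'cV[K]_p) := ler_normD a b.
have Rs : subdiff R xs (- (L^T *m ws)).
  apply: subdiff_limit => // e e0.
  (* The residual is at most [gR^-1 d + 2 C' d], which is below [d D = e]. *)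
  pose D := 1 + gR^-1 + 2 * C'; have D0 : 0 < D by rewrite /D; lra.
  pose d := e / D; have d0 : 0 < d by rewrite divr_gt0.
  have dE : d * D = e by rewrite divfK// gt_eqF.
  have de : d < e by rewrite ltr_pdivrMr// ltr_pMr// /D; lra.
  have [k [xk wk dx dw]] := near d d0; exists (x k.+1); eexists; split.
  - exact: pd_step_primal.
  - exact: lt_trans xk de.
  - have -> : gR^-1 *: (x k - gR *: (L^T *m w k) - x k.+1) - - (L^T *m ws) =
      gR^-1 *: (x k - x k.+1) - L^T *m ((w k - w k.+1) + (w k.+1 - ws)).
      rewrite addrA subrK mulmxBr; move: (L^T *m _) (L^T *m _) => p q.
      by apply/matrixP => i t; rewrite !mxE; field; rewrite gt_eqF.
    have := ler_normB (gR^-1 *: (x k - x k.+1)) (L^T *m ((w k - w k.+1) + (w k.+1 - ws))).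
    rewrite normrZ gtr0_norm// => h; apply: (le_lt_trans h).
    have := LC' ((w k - w k.+1) + (w k.+1 - ws)).
    have := ler_wpM2l (ltW C'0) (tri _ (w k - w k.+1) (w k.+1 - ws)).
    have := ler_wpM2l (ltW C'0) (ltW dw); have := ler_wpM2l (ltW C'0) (ltW wk).
    have := ler_wpM2l (ltW r0) (ltW dx).
    move: dE d0; rewrite /D; clearbody d; move: (gR^-1) => r dE d0; lra.
have Js : subdiff J (L *m xs) ws.
  apply: subdiff_limit => // e e0.
  pose D := 1 + gJ^-1 + 2 * C; have D0 : 0 < D by rewrite /D; lra.
  pose d := e / D; have d0 : 0 < d by rewrite divr_gt0.
  have dE : d * D = e by rewrite divfK// gt_eqF.
  have de : d < e by rewrite ltr_pdivrMr// ltr_pMr// /D; lra.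
  have [k [xk wk dx dw]] := near d d0; eexists; exists (w k.+1); split.
  (* The dual step yields a subgradient of [fenchel J]; inverted, it is one of [J] at a point close
     to [L *m xs]. *)
  - exact: subdiff_fenchel_inv HJ J0 (pd_step_dual k).
  - have -> : gJ^-1 *: (w k + gJ *: (L *m (x k.+1 + (x k.+1 - x k))) - w k.+1) - L *m xs =
      gJ^-1 *: (w k - w k.+1) + L *m ((x k.+1 - xs) - (x k - x k.+1)).
      rewrite !(mulmxBr, mulmxDr); move: (L *m _) (L *m _) (L *m _) => p q s.
      by apply/matrixP => i t; rewrite !mxE; field; rewrite gt_eqF.
    have := ler_normD (gJ^-1 *: (w k - w k.+1)) (L *m ((x k.+1 - xs) - (x k - x k.+1))).
    rewrite normrZ gtr0_norm// => h; apply: (le_lt_trans h).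
    have := LC ((x k.+1 - xs) - (x k - x k.+1)).
    have := ler_wpM2l (ltW C0) (ler_normB (x k.+1 - xs) (x k - x k.+1)).
    have := ler_wpM2l (ltW C0) (ltW dx); have := ler_wpM2l (ltW C0) (ltW xk).
    have := ler_wpM2l (ltW j0) (ltW dw).
    move: dE d0; rewrite /D; clearbody d; move: (gJ^-1) => r dE d0; lra.
  - exact: lt_trans wk de.
have conv e : 0 < e -> exists N, forall k, (N <= k)%N -> `|x k - xs| < e /\ `|w k - ws| < e.
  move=> e0; have [d d0 dP] := pd_form_small e0.
  have [D D0 DP] := pd_form_upper L HgR HgJ.
  (* [V] is now centred at the cluster point, and one small value keeps it small. The cut at 1 gives
     [s ^+ 2 <= s]. *)
  have s0 : 0 < Num.min 1 (d / D) by rewrite lt_min ltr01 divr_gt0.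
  have [N _ [xN wN]] := cl _ s0 0%N; exists N => k Nk; apply: dP.
  apply: le_lt_trans (pd_lyapunov_mono Rs Js Nk) _.
  pose s := Num.max `|x N - xs| `|w N - ws|.
  have ss : s < Num.min 1 (d / D) by rewrite gt_max xN.
  have s00 : 0 <= s by rewrite le_max normr_ge0.
  have xs_s : `|x N - xs| <= s by rewrite le_max lexx.
  have ws_s : `|w N - ws| <= s by rewrite le_max lexx orbT.
  apply: le_lt_trans (DP _ _ s xs_s ws_s) _.
  move: ss; rewrite lt_min => /andP[s1 sd].
  rewrite mulrC -ltr_pdivlMr//; apply: le_lt_trans sd.
  by rewrite expr2 ler_piMr// ltW.
by split => //; apply/cvgrPdist_lt => e e0; have [N NP] := conv e e0;
  exists N => // k /= Nk; rewrite distrC; have [] := NP k Nk.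
Qed.

End PrimalDualLimit.

(* Locked: conversion problems that unfold ['d] do not terminate in practice. *)
HB.lock Definition grad (K : realType) n (g : 'cV[K]_n -> K) (x : 'cV[K]_n) :
    'cV[K]_n :=
  \col_j 'd g x (delta_mx j 0).

HB.lock Definition hess (K : realType) n (g : 'cV[K]_n -> K) (x : 'cV[K]_n) :
    'M[K]_n :=
  \matrix_(i, j) 'd (fun y => 'd g y (delta_mx i 0)) x (delta_mx j 0).

(** * Strict differentiability and metric regularity *)

Section StrictDifferentiability.
Context {K : realType}.

Definition strict_diff n p (F : 'cV[K]_n -> 'cV[K]_p) (A : 'M[K]_(p, n))
    (x : 'cV[K]_n) :=
  forall e : K, 0 < e -> exists2 d : K, 0 < d &
    forall y y' : 'cV[K]_n, `|y - x| < d -> `|y' - x| < d ->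
      `|F y - F y' - A *m (y - y')| <= e * `|y - y'|.

Lemma coordB n (u v : 'cV[K]_n) i a b :
  u i 0 = a -> v i 0 = b -> (u - v) i 0 = a - b.
Proof. by move=> <- <-; rewrite !mxE. Qed.

Lemma coord_residual n (u v w : 'cV[K]_n) i a b c :
  u i 0 = a -> v i 0 = b -> w i 0 = c -> (u - v - w) i 0 = a - b - c.
Proof. by move=> <- <- <-; rewrite !mxE. Qed.

Lemma diff_grad n (g : 'cV[K]_n -> K) (x v : 'cV[K]_n) : 'd g x v = dotp (grad g x) v.
Proof.
rewrite {1}[v]matrix_sum_delta linear_sum; apply: eq_bigr => i _.
by rewrite big_ord1 linearZ /= grad.unlock mxE [RHS]mulrC.
Qed.

Lemma grad_coord n (g : 'cV[K]_n -> K) (x : 'cV[K]_n) i :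
  grad g x i 0 = 'd g x (delta_mx i 0).
Proof. by rewrite grad.unlock; exact: mxE. Qed.

Lemma hess_mulmx_coord n (g : 'cV[K]_n -> K) (x v : 'cV[K]_n) i :
  (hess g x *m v) i 0 = dotp (grad (fun y => 'd g y (delta_mx i 0)) x) v.
Proof.
by rewrite hess.unlock grad.unlock mxE; apply: eq_bigr => j _; rewrite 2!mxE.
Qed.

Lemma is_derive_line n (g : 'cV[K]_n -> K) (y v : 'cV[K]_n) (t : K) :
  differentiable g (y + t *: v) ->
  is_derive t 1 (fun t : K => g (y + t *: v)) (dotp (grad g (y + t *: v)) v).
Proof.
move=> dg; pose f t := g (y + t *: v).
have quot : (fun h => h^-1 *: ((f \o shift t) (h *: 1) - f t)) =
    (fun h => h^-1 *: ((g \o shift (y + t *: v)) (h *: v) - g (y + t *: v))).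
  apply/funext => h; rewrite /f /= [h *: 1]mulr1 scalerDl.
  by congr (_ *: (g _ - _)); rewrite addrCA addrA.
split; first by rewrite /derivable quot; exact: diff_derivable.
by rewrite -diff_grad -deriveE// /derive quot.
Qed.

Lemma mvt_segment n (g : 'cV[K]_n -> K) (y v : 'cV[K]_n) :
  (forall t, 0 <= t <= 1 -> differentiable g (y + t *: v)) ->
  exists2 t, 0 < t < 1 & g (y + v) - g y = dotp (grad g (y + t *: v)) v.
Proof.
move=> dg; pose f (t : K) := g (y + t *: v).
have df (t : K) : 0 <= t <= 1 -> is_derive t 1 f (dotp (grad g (y + t *: v)) v).
  by move=> t01; exact: is_derive_line (dg t t01).
have [t|t|t t01] := @MVT _ f (fun t => dotp (grad g (y + t *: v)) v) 0 1 ltr01.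
- by rewrite in_itv /= => /andP[t0 t1]; apply: df; rewrite !ltW.
- apply: derivable_within_continuous => s; rewrite in_itv /= => s01.
  by have [] := df s s01.
by rewrite /f scale1r scale0r addr0 subr0 mulr1; exists t.
Qed.

Lemma segment_near n (x y v : 'cV[K]_n) d (t : K) :
  `|y - x| < d -> `|y + v - x| < d -> 0 <= t <= 1 -> `|y + t *: v - x| < d.
Proof.
move=> yd vd /andP[t0 t1].
have -> : y + t *: v - x = (1 - t) *: (y - x) + t *: (y + v - x).
  by apply/matrixP => i j; rewrite !mxE; ring.
apply: (le_lt_trans (ler_normD _ _)); rewrite !normrZ !ger0_norm ?subr_ge0//.
have := ler_wpM2l t0 (ltW vd).
(* The strict inequality is taken from an end of the segment with nonzero weight. *)
have [->|t_neq1] := eqVneq t 1; first by rewrite subrr mul0r; lra.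
have s0 : 0 < 1 - t by rewrite subr_gt0 lt_neqAle t_neq1.
by move: yd; rewrite -(ltr_pM2l s0); lra.
Qed.

(** Puts finitely many local estimates, one per coordinate or constraint, on one ball; the minimum
    starts at 1 to cover [k = 0]. *)
Lemma common_radius k (P : 'I_k -> K -> Prop) :
  (forall i, exists2 d, 0 < d & P i d) ->
  (forall i d d', d' <= d -> P i d -> P i d') ->
  exists2 d, 0 < d & forall i, P i d.
Proof.
move=> ex mono.
have /choice[d dP] : forall i, exists d, 0 < d /\ P i d.
  by move=> i; have [d d0 Pd] := ex i; exists d.
exists (\big[Num.min/1]_i d i) => [|i].
  by apply/bigmin_gtP; split => // i _; have [] := dP i.
by apply: mono (dP i).2; exact: bigmin_le_cond.
Qed.

(** The mean value theorem on the segment from [y'] to [y], the gradient at the intermediate point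
    being compared with that at [x]. *)
Lemma strict_diff_scalar n (g : 'cV[K]_n -> K) (x : 'cV[K]_n) :
  (exists2 r : K, 0 < r & forall y : 'cV[K]_n, `|y - x| < r -> differentiable g y) ->
  (forall v : 'cV[K]_n, {for x, continuous (fun y : 'cV[K]_n => 'd g y v)}) ->
  forall e : K, 0 < e -> exists2 d : K, 0 < d &
    forall y y' : 'cV[K]_n, `|y - x| < d -> `|y' - x| < d ->
      `|g y - g y' - dotp (grad g x) (y - y')| <= e * `|y - y'|.
Proof.
move=> [d1 d10 dg] cg e e0.
(* Pays for the factor [n] of [dotp_norm_le]; [n.+1] keeps the denominator nonzero. *)
pose e' := e / n.+1%:R; have e'0 : 0 < e' by rewrite divr_gt0.
have [|i d d' dd' Pd y yd|d2 d20 cgP] := @common_radius n (fun j d => forall y : 'cV[K]_n,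
  `|y - x| < d -> `|'d g y (delta_mx j 0) - 'd g x (delta_mx j 0)| < e').
- move=> j; have /cvgrPdistC_lt/(_ e' e'0)/nbhs_cvP[d d0 dP] := cg (delta_mx j 0).
  by exists d.
- by apply: Pd; apply: lt_le_trans yd dd'.
exists (Num.min d1 d2) => [|y y']; first by rewrite lt_min d10.
have key v : `|y' - x| < Num.min d1 d2 -> `|y' + v - x| < Num.min d1 d2 ->
    `|g (y' + v) - g y' - dotp (grad g x) v| <= e * `|v|.
  move=> y'd vd; have seg (t : K) : 0 <= t <= 1 -> `|y' + t *: v - x| < Num.min d1 d2.
    exact: segment_near.
  have [t t01|t /andP[t0 t1] ->] := @mvt_segment _ g y' v.
    by apply: dg; have := seg t t01; rewrite lt_min => /andP[].
  have : `|grad g (y' + t *: v) - grad g x| <= e'.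
    apply/cv_norm_le => [|j]; first exact: ltW.
    have := seg t; rewrite (ltW t0) (ltW t1) lt_min => /(_ isT)/andP[_ ty].
    apply: ltW; apply: (eq_ind_r (fun r => `|r| < e') (cgP j _ ty)).
    exact: coordB (grad_coord _ _ _) (grad_coord _ _ _).
  rewrite -dotpNl -dotpDl; move: (grad _ _ - _) => G Ge.
  apply: (le_trans (dotp_norm_le _ _)); rewrite ler_wpM2r//.
  apply: (le_trans (ler_wpM2l (ler0n K n) Ge)).
  by rewrite /e' mulrCA ger_pMr// ler_pdivrMr// mul1r ler_nat.
move=> yd y'd; have := key (y - y') y'd.
by rewrite [y' + _]addrC subrK => /(_ yd).
Qed.

Lemma C2_on_strict_diff n (V : set 'cV[K]_n) g (x : 'cV[K]_n) :
  open V -> V x -> C2_on V g ->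
  (forall e : K, 0 < e -> exists2 d : K, 0 < d &
    forall y y' : 'cV[K]_n, `|y - x| < d -> `|y' - x| < d ->
      `|g y - g y' - dotp (grad g x) (y - y')| <= e * `|y - y'|) /\
  strict_diff (grad g) (hess g x) x.
Proof.
move=> oV Vx gV; have /nbhs_cvP[r r0 rV] : nbhs x V by exact: open_nbhs_nbhs.
split=> [e e0|e e0].
  have [||d d0 dP] := @strict_diff_scalar _ g x _ _ e e0.
  - by exists r => // y /rV/gV[].
  - by move=> v; apply: differentiable_continuous; have [_ /(_ v)[]] := gV x Vx.
  by exists d.
have [i|i d d' dd' Pd y y' yd yd'|d d0 dP] := @common_radius n (fun i d => forall y y' : 'cV[K]_n,
    `|y - x| < d -> `|y' - x| < d ->
    `|(grad g y - grad g y' - hess g x *m (y - y')) i 0| <= e * `|y - y'|).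
- pose gi y := 'd g y (delta_mx i 0).
  have [||d d0 dP] := @strict_diff_scalar _ gi x _ _ e e0.
  + by exists r => // y /rV/gV[_ /(_ (delta_mx i 0))[]].
  + by move=> v; have [_ /(_ (delta_mx i 0))[_]] := gV x Vx; apply.
  exists d => // y y' yd yd'.
  have E := coord_residual (grad_coord g y i) (grad_coord g y' i)
    (hess_mulmx_coord g x (y - y') i).
  exact: (eq_ind_r (fun r => `|r| <= e * `|y - y'|) (dP y y' yd yd') E).
- by apply: Pd; [exact: lt_le_trans yd dd'|exact: lt_le_trans yd' dd'].
exists d => // y y' yd yd'; apply/cv_norm_le => [|i]; last exact: dP.
by rewrite mulr_ge0// ltW.
Qed.

Lemma strict_diff_lipschitz n p (F : 'cV[K]_n -> 'cV[K]_p) A (x : 'cV[K]_n) :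
  strict_diff F A x -> exists C d : K, [/\ 0 < C, 0 < d &
    forall y y' : 'cV[K]_n, `|y - x| < d -> `|y' - x| < d ->
      `|F y - F y'| <= C * `|y - y'|].
Proof.
move=> sF; have [d d0 dP] := sF 1 ltr01; have [C C0 AC] := mulmx_norm_bound A.
exists (1 + C), d; split => // [|y y' yd yd']; first by lra.
have := ler_normD (F y - F y' - A *m (y - y')) (A *m (y - y')).
by rewrite subrK; have := dP y y' yd yd'; have := AC (y - y'); lra.
Qed.

(* Graves: along the range of a right inverse A of B, [s |-> s - F (p + A s)] is
   a contraction *)
Lemma metric_regularity n k (F : 'cV[K]_n -> 'cV[K]_k) B A
    (x : 'cV[K]_n) :
  strict_diff F B x -> F x = 0 -> B *m A = 1%:M ->
  exists2 d : K, 0 < d & forall p : 'cV[K]_n, `|p - x| < d ->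
    exists s : 'cV[K]_k, F (p + A *m s) = 0 /\ `|s| <= 2 * `|F p|.
Proof.
move=> sF Fx BA; have [C C0 AC] := mulmx_norm_bound A.
(* As [|A *m s| <= C * |s|], this accuracy makes [T] contract by 1/2. *)
have [|d d0 dP] := sF (2 * C)^-1; first by rewrite invr_gt0 mulr_gt0.
have [D [d' [D0 d'0 FD]]] := strict_diff_lipschitz sF.
(* A correction moves [p] by at most [2 * C * |F p| <= 2 * C * D * |p - x|], below [d / 2] by the
   last bound; the first one leaves [d / 2] for [p] itself. *)
pose r := Num.min (d / 2) (Num.min d' (d / (4 * C * D))).
exists r => [|p]; first by rewrite !lt_min d'0 !divr_gt0// !mulr_gt0.
rewrite !lt_min => /and3P[pd pd' pD].
pose T s := s - F (p + A *m s).
pose U := [set s : 'cV[K]_k | `|s| <= 2 * `|F p|].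
have Fp : C * (2 * `|F p|) < d / 2.
  have := FD p x pd'; rewrite subrr normr0 Fx subr0 => /(_ d'0) h.
  have := ler_wpM2l (ltW C0) h; move: pD.
  rewrite ltr_pdivlMr ?mulr_gt0//; lra.
have near s : U s -> `|p + A *m s - x| < d.
  move=> Us; rewrite addrAC; apply: (le_lt_trans (ler_normD _ _)).
  by have := AC s; have := ler_wpM2l (ltW C0) Us; lra.
have TL s s' : U s -> U s' -> `|T s - T s'| <= 2^-1 * `|s - s'|.
  move=> Us Us'; have := dP _ _ (near s Us) (near s' Us').
  have -> : (p + A *m s) - (p + A *m s') = A *m (s - s').
    by rewrite mulmxBr opprD addrACA subrr add0r.
  rewrite mulmxA BA mul1mx -normrN => h.
  have -> : T s - T s' = - (F (p + A *m s) - F (p + A *m s') - (s - s')).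
    by rewrite /T; apply/matrixP => i j; rewrite !mxE; ring.
  apply: (le_trans h); rewrite invfM mulrAC -mulrA ler_pM2l ?invr_gt0//.
  by rewrite ler_pdivrMr// mulrC.
have U0 : U 0 by rewrite /U /= normr0 mulr_ge0.
(* [T 0 = - F p] has half the radius of [U] as its norm; the contraction adds at most the other
   half. *)
have TU s : U s -> U (T s).
  move=> Us; have := TL s 0 Us U0; have := ler_normD (T s - T 0) (T 0).
  rewrite subrK subr0 {2 4}/T mulmx0 addr0 sub0r normrN.
  by move: Us; rewrite /U /=; lra.
pose T' : {fun U >-> U} := HB.pack_for {fun U >-> U} T (isFun.Build _ _ U U T TU).
have cT : is_contraction T'.
  exists (2^-1)%:nng; split; first by rewrite /= invf_lt1// ltr1n.
  by move=> [s s'] [/= Us Us']; exact: TL.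
have cU : closed U.
  rewrite (_ : U = Num.norm @^-1` [set a | a <= 2 * `|F p|])//.
  by apply: closed_comp; [move=> ? _; exact: norm_continuous|exact: closed_le].
pose X : completeNormedModType K := HB.pack 'cV[K]_k.
have [|s Us sT] := @banach_fixed_point K X U T' cT cU; first by exists 0.
exists s; split => //; have /eqP : s = s - F (p + A *m s) := sT.
by rewrite -subr_eq0 opprB addrC subrK => /eqP.
Qed.

End StrictDifferentiability.

(** * Orthogonality, affine hulls and relative interiors *)

Section Subspaces.
Context {K : realType}.

Lemma common_bound k (P : 'I_k -> K -> Prop) :
  (forall i, exists2 C, 0 < C & P i C) ->
  (forall i C C', C <= C' -> P i C -> P i C') ->
  exists2 C, 0 < C & forall i, P i C.
Proof.
move=> ex mono; have /choice[C CP] : forall i, exists C, 0 < C /\ P i C.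
  by move=> i; have [C C0 PC] := ex i; exists C.
exists (\big[Num.max/1]_i C i) => [|i]; first by apply: lt_le_trans (bigmax_ge_id _ _ _ _).
by apply: mono (CP i).2; exact: le_bigmax.
Qed.

Lemma norm_sum_scale k n (a : 'I_k -> K) (v : 'I_k -> 'cV[K]_n) s t :
  (forall i, `|a i| <= s) -> (forall i, `|v i| <= t) ->
  `|\sum_i a i *: v i| <= k%:R * s * t.
Proof.
move=> as_ vt; apply: (le_trans (ler_norm_sum _ _ _)).
apply: (le_trans (ler_sum _ (G := fun=> s * t) _)) => [i _|].
  by rewrite normrZ ler_pM.
by rewrite sumr_const card_ord -[leLHS]mulr_natl mulrA.
Qed.

(** The columns of [cokermx B] lie in the kernel of [B], and orthogonality to them tests membership
    in its row space. *)
Lemma orthogonal_ker_range n k (B : 'M[K]_(k, n)) (G : 'cV[K]_n) :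
  (forall v : 'cV[K]_n, B *m v = 0 -> dotp G v = 0) ->
  exists l : 'cV[K]_k, G = B^T *m l.
Proof.
move=> BG; have /submxP[l lE] : (G^T <= B)%MS.
  rewrite submxE; apply/eqP/matrixP => i j.
  have := BG (col j (cokermx B)); rewrite colE mulmxA mulmx_coker mul0mx => /(_ erefl).
  by rewrite dotp_mxE mulmxA -colE ord1 !mxE.
by exists l^T; rewrite -trmx_mul -lE trmxK.
Qed.

(** A matrix of maximal rank among those with rows in [S] has row space [S], which reduces the claim
    to [orthogonal_ker_range]. *)
Lemma double_orthoc n (S : set 'cV[K]_n) b :
  S 0 -> (forall a u v, S u -> S v -> S (a *: u + v)) ->
  orthoc (orthoc S) b -> S b.
Proof.
move=> S0 Slin bS.
pose P r := `[< exists m (W : 'M[K]_(m, n)), (forall i, S (row i W)^T) /\ \rank W = r >].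
have P0 : P 0%N.
  by apply/asboolP; exists 0%N, 0; split; [case|rewrite mxrank0].
have Pub r : P r -> (r <= n)%N by move=> /asboolP[m [W [_ <-]]]; exact: rank_leq_col.
case: (@ex_maxnP P n (ex_intro _ 0%N P0) Pub) => r /asboolP[m [W [WS rW]]] rmax.
have SW s : S s -> (s^T <= W)%MS.
  move=> Ss; have WW' : (W <= col_mx W s^T)%MS by rewrite -addsmxE addsmxSl.
  have : (\rank (col_mx W s^T) <= \rank W)%N.
    rewrite rW; apply: rmax; apply/asboolP; exists (m + 1)%N, (col_mx W s^T).
    split => // i; case: (split_ordP i) => j ->; first by rewrite rowKu.
    by rewrite rowKd row_id trmxK.
  rewrite (geq_leqif (mxrank_leqif_sup WW')); apply: submx_trans.
  by rewrite -addsmxE addsmxSr.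
have [v Wv|l ->] := @orthogonal_ker_range _ _ W b.
  by rewrite dotpC; apply: bS => s /SW/submxP[C sE]; rewrite dotp_mxE sE -mulmxA Wv mulmx0 mxE.
rewrite -[_ *m _]trmxK trmx_mul trmxK mulmx_sum_row raddf_sum /=.
apply: (big_rec S) => // j u _ Su; rewrite linearZ /=; exact: Slin.
Qed.

Lemma aff_singleton n (C : set 'cV[K]_n) x : C x -> aff C x.
Proof.
move=> Cx; exists 1%N, (fun=> 1), (fun=> x); split => //.
  by rewrite big_ord1.
by rewrite big_ord1 scale1r.
Qed.

(** Three affine combinations are concatenated, with weights [ap], [t * au], [- t * av] of total
    [1 + t - t]. *)
Lemma aff_translate n (C : set 'cV[K]_n) p u v t :
  aff C p -> aff C u -> aff C v -> aff C (p + t *: (u - v)).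
Proof.
move=> [kp [ap [cp [Cp sp ->]]]] [ku [au [cu [Cu su ->]]]] [kv [av [cv [Cv sv ->]]]].
exists (kp + (ku + kv))%N.
pose glue T (a : 'I_kp -> T) (b : 'I_ku -> T) (c : 'I_kv -> T)
    (i : 'I_(kp + (ku + kv))) : T :=
  match fintype.split i with
  | inl i => a i
  | inr i => match fintype.split i with inl i => b i | inr i => c i end
  end.
exists (glue K ap (fun i => t * au i) (fun i => - t * av i)), (glue _ cp cu cv).
split.
- by move=> i; rewrite /glue; case: fintype.split => // j; case: fintype.split.
- rewrite big_split_ord big_split_ord /= /glue.
  under eq_bigr do rewrite (unsplitK (inl _)).
  under [X in _ + (X + _)]eq_bigr do rewrite (unsplitK (inr _)) (unsplitK (inl _)).
  under [X in _ + (_ + X)]eq_bigr do rewrite (unsplitK (inr _)) (unsplitK (inr _)).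
  by rewrite -!mulr_sumr sp su sv; ring.
rewrite big_split_ord big_split_ord /= /glue.
under [in RHS]eq_bigr do rewrite (unsplitK (inl _)).
under [X in _ = _ + (X + _)]eq_bigr do rewrite (unsplitK (inr _)) (unsplitK (inl _)) -scalerA.
under [X in _ = _ + (_ + X)]eq_bigr do rewrite (unsplitK (inr _)) (unsplitK (inr _)) -scalerA.
by rewrite -!scaler_sumr scaleNr -scalerBr.
Qed.

Lemma par_double_orthoc n (C : set 'cV[K]_n) x b :
  C x -> orthoc (orthoc (par C)) b -> par C b.
Proof.
move=> Cx; apply: double_orthoc.
  by exists x; [exact: aff_singleton|exists x; [exact: aff_singleton|rewrite subrr]].
move=> a _ _ [p Cp [q Cq <-]] [u Cu [v Cv <-]].
exists (u + a *: (p - q)); first exact: aff_translate.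
by exists v => //; rewrite addrAC addrC.
Qed.

(** Directions in [par C] stay in the affine hull, where [u] is interior. They are given in the
    double orthogonal because sharpness describes [par] through its orthogonal. *)
Lemma ri_perturbation n k (C : set 'cV[K]_n) u (b : 'I_k -> 'cV[K]_n) :
  ri C u -> (forall i, orthoc (orthoc (par C)) (b i)) ->
  exists2 d : K, 0 < d & forall i t, `|t| <= d -> C (u + t *: b i).
Proof.
move=> [Cu /nbhs_cvP[e e0 eC]] bC.
apply: (@common_radius _ _ (fun i d => forall t, `|t| <= d -> C (u + t *: b i))).
  move=> i; exists (e / (1 + `|b i|)) => [|t tb].
    by rewrite divr_gt0// ltr_pwDl.
  have b0 : 0 < 1 + `|b i| by rewrite ltr_pwDl.
  apply: eC; last first.
    have [p Cp [q Cq <-]] := par_double_orthoc Cu (bC i).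
    by apply: aff_translate => //; exact: aff_singleton.
  rewrite addrAC subrr add0r normrZ; move: tb; rewrite ler_pdivlMr//.
  have [->|t0] := eqVneq t 0; first by rewrite normr0 !mul0r.
  have : 0 < `|t| by rewrite normr_gt0.
  rewrite mulrDr mulr1; lra.
by move=> i d d' dd' H t td; apply: H; exact: le_trans td dd'.
Qed.

(** A discrete product rule. In use, [a], [b], [c] are the constraint gradients at [x'], [x] and
    [xb], with multipliers [l'], [l], [lb], and [h] are the Hessian terms. *)
Lemma sum_scale_increment (I : finType) n (l l' lb dl dlb : I -> K)
    (a b c h : I -> 'cV[K]_n) :
  (forall i, dl i = l' i - l i) -> (forall i, dlb i = l i - lb i) ->
  \sum_i l' i *: a i - \sum_i l i *: b i - \sum_i lb i *: h i - \sum_i dl i *: c i =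
  \sum_i l i *: (a i - b i - h i) + \sum_i dlb i *: h i + \sum_i dl i *: (a i - c i).
Proof.
move=> dlE dlbE; rewrite -!sumrB -!big_split; apply: eq_bigr => i _ /=.
by rewrite dlE dlbE; apply/matrixP => p q; rewrite !mxE; ring.
Qed.

Lemma unitmx_of_ker n (G : 'M[K]_n) :
  (forall v : 'cV[K]_n, G *m v = 0 -> v = 0) -> G \in unitmx.
Proof.
move=> kerG; rewrite -unitmx_tr -row_free_unit -kermx_eq0; apply/eqP/row_matrixP => i.
rewrite row0 -[LHS]trmxK; apply/eqP; rewrite trmx_eq0; apply/eqP/kerG.
by apply: trmx_inj; rewrite trmx_mul trmxK -row_mul mulmx_ker row0 trmx0.
Qed.

End Subspaces.

(** * First- and second-order expansions of the constraints *)

Section Constraints.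
Context {K : realType} {n k : nat}.
Implicit Types (Phi : 'I_k -> 'cV[K]_n -> K) (V : set 'cV[K]_n) (x y : 'cV[K]_n).

Definition constraint Phi y : 'cV[K]_k := \col_i Phi i y.

Definition constraint_jac Phi y : 'M[K]_(k, n) :=
  \matrix_(i, j) grad (Phi i) y j 0.

Lemma constraint_jac_coord Phi y (v : 'cV[K]_n) i :
  (constraint_jac Phi y *m v) i 0 = dotp (grad (Phi i) y) v.
Proof. by rewrite mxE; apply: eq_bigr => j _; rewrite mxE. Qed.

Lemma constraint_jac_tr Phi y (l : 'cV[K]_k) :
  (constraint_jac Phi y)^T *m l = \sum_i l i 0 *: grad (Phi i) y.
Proof.
apply/colP => j; rewrite mxE summxE; apply: eq_bigr => i _.
by rewrite !mxE mulrC.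
Qed.

Lemma constraint_strict_diff Phi V y :
  open V -> V y -> (forall i, C2_on V (Phi i)) ->
  strict_diff (constraint Phi) (constraint_jac Phi y) y.
Proof.
move=> oV Vy PhiV e e0.
have [i|i d d' dd' Pd a b ad bd|d d0 dP] := @common_radius _ k (fun i d =>
    forall a b : 'cV[K]_n, `|a - y| < d -> `|b - y| < d ->
    `|Phi i a - Phi i b - dotp (grad (Phi i) y) (a - b)| <= e * `|a - b|).
- by have [/(_ e e0)] := C2_on_strict_diff oV Vy (PhiV i).
- by apply: Pd; [exact: lt_le_trans ad dd'|exact: lt_le_trans bd dd'].
exists d => // a b ad bd; apply/cv_norm_le => [|i].
  by rewrite mulr_ge0// ltW.
have FE c : constraint Phi c i 0 = Phi i c by rewrite mxE.
by rewrite (coord_residual (FE a) (FE b) (constraint_jac_coord Phi y (a - b) i)) dP.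
Qed.

Lemma constraint_jac_right_inverse Phi y :
  (forall a : 'I_k -> K, exists v : 'cV[K]_n, forall i, 'd (Phi i) y v = a i) ->
  exists A, constraint_jac Phi y *m A = 1%:M.
Proof.
move=> surj; have /choice[v vP] : forall j, exists v : 'cV[K]_n, forall i,
    dotp (grad (Phi i) y) v = (i == j)%:R.
  move=> j; have [v vj] := surj (fun i => (i == j)%:R).
  by exists v => i; rewrite -diff_grad.
exists (\matrix_(l, j) v j l 0); apply/matrixP => i j.
rewrite !mxE -vP; apply: eq_bigr => l _.
by rewrite !mxE.
Qed.

Lemma grad_strict_diff_family Phi V x : open V -> V x ->
  (forall i, C2_on V (Phi i)) -> forall e : K, 0 < e -> exists2 d : K, 0 < d &
    forall i y y', `|y - x| < d -> `|y' - x| < d ->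
    `|grad (Phi i) y - grad (Phi i) y' - hess (Phi i) x *m (y - y')| <= e * `|y - y'|.
Proof.
move=> oV Vx PhiV e e0; apply: (@common_radius _ k (fun i d => forall y y' : 'cV[K]_n,
    `|y - x| < d -> `|y' - x| < d ->
    `|grad (Phi i) y - grad (Phi i) y' - hess (Phi i) x *m (y - y')| <= e * `|y - y'|)).
  by move=> i; have [_ /(_ e e0)] := C2_on_strict_diff oV Vx (PhiV i).
move=> i d d' dd' Pd y y' yd yd'.
by apply: Pd; [exact: lt_le_trans yd dd'|exact: lt_le_trans yd' dd'].
Qed.

(* second-order expansion, by the mean value theorem applied to
   [t |-> g (x + t v) - t <grad g x, v> - t^2 <hess g x v, v> / 2] *)
Lemma taylor2 (g : 'cV[K]_n -> K) V x : open V -> V x -> C2_on V g ->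
  forall e : K, 0 < e -> exists2 d : K, 0 < d & forall v, `|v| < d ->
    `|g (x + v) - g x - dotp (grad g x) v - 2^-1 * dotp (hess g x *m v) v|
      <= e * `|v| ^+ 2.
Proof.
move=> oV Vx gV e e0; have [_ sg] := C2_on_strict_diff oV Vx gV.
have /nbhs_cvP[r r0 rV] : nbhs x V by exact: open_nbhs_nbhs.
pose e' := e / n.+1%:R; have e'0 : 0 < e' by rewrite divr_gt0.
have ne' : n%:R * e' <= e.
  by rewrite /e' mulrCA ger_pMr// ler_pdivrMr// mul1r ler_nat.
have [d d0 dP] := sg e' e'0.
exists (Num.min r d) => [|v]; first by rewrite lt_min r0.
rewrite lt_min => /andP[vr vd].
have small (t : K) s : 0 <= t <= 1 -> `|v| < s -> `|x + t *: v - x| < s.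
  move=> /andP[t0 t1] vs; rewrite addrAC subrr add0r normrZ ger0_norm//.
  by apply: le_lt_trans vs; rewrite ler_piMl.
set a := dotp (grad g x) v; set b := dotp (hess g x *m v) v.
pose p (t : K) := g (x + t *: v) - (t * a + t ^+ 2 * (2^-1 * b)).
pose dp (t : K) := dotp (grad g (x + t *: v)) v - (a + t * b).
have dpP (t : K) : 0 <= t <= 1 -> is_derive t 1 p (dp t).
  move=> t01; have dg : differentiable g (x + t *: v).
    by have [] := gV _ (rV _ (small _ _ t01 vr)).
  have := is_derive_line dg => dline.
  rewrite {}/p {}/dp; clearbody a b.
  have -> : (fun t : K => g (x + t *: v) - (t * a + t ^+ 2 * (2^-1 * b))) =
      (fun t => g (x + t *: v)) -
      (a *: (id : K -> K) + (2^-1 * b) *: ((id : K -> K) ^+ 2)).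
    by apply/funext => u; rewrite !fctE /GRing.scale /=; ring.
  move: (fun t : K => g (x + t *: v)) (dotp (grad g (x + t *: v)) v) dline => f0 c0 dline.
  have did := is_derive_id t (1 : K).
  have dq := is_deriveB dline (is_deriveD (is_deriveZ a did)
    (is_deriveZ (2^-1 * b) (is_deriveX 2%N did))).
  apply: (is_derive_eq dq).
  rewrite /GRing.scale /=.
  congr (_ - _).
  by field.
have [t|t|t t01 pE] := @MVT _ p dp 0 1 ltr01.
- by rewrite in_itv /= => /andP[t0 t1]; apply: dpP; rewrite !ltW.
- apply: derivable_within_continuous => s; rewrite in_itv /= => s01.
  by have [] := dpP s s01.
have {}t01 : 0 < t < 1 by move: t01; rewrite in_itv.
have [t0 t1] := andP t01.
have t01' : 0 <= t <= 1 by rewrite !ltW.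
move: pE; rewrite /p scale1r scale0r addr0 !mul0r mul1r expr0n /= mul0r !addr0 expr1n mul1r.
rewrite !subr0 mulr1 => pE.
have -> : g (x + v) - g x - a - 2^-1 * b = dp t by rewrite -pE; ring.
(* The derivative is the first-order remainder of [grad g] paired with [v], which strict
   differentiability of the gradient bounds. *)
have -> : dp t = dotp (grad g (x + t *: v) - grad g x - hess g x *m (t *: v)) v.
  by rewrite /dp -scalemxAr !dotpE /a /b; ring.
apply: (le_trans (dotp_norm_le _ _)); rewrite expr2 mulrA ler_wpM2r//.
have := dP (x + t *: v) x (small _ _ t01' vd); rewrite subrr normr0 => /(_ d0).
rewrite [x + _ - x]addrAC subrr add0r normrZ gtr0_norm// => h.
apply: (le_trans (ler_wpM2l (ler0n K n) h)).
rewrite 2!mulrA -[X in X * _ * _]/(n%:R * e') -[leLHS]mulrA.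
apply: ler_pM => //; first by rewrite mulr_ge0// ltW.
  by rewrite mulr_ge0// ltW.
by rewrite ler_piMl// ltW.
Qed.

End Constraints.

(** * Local structure of the subdifferential of a partly smooth function *)

Section PartlySmoothLocal.
Context {K : realType} {n k : nat}.
Variables (f : 'cV[K]_n -> \bar K) (M V : set 'cV[K]_n) (xb ub : 'cV[K]_n).
Variables (Phi : 'I_k -> 'cV[K]_n -> K) (g : 'cV[K]_n -> K).
Hypotheses (pf : proper f) (fub : subdiff f xb ub) (Mxb : M xb).
Hypotheses (oV : open V) (Vxb : V xb).
Hypotheses (PhiV : forall i, C2_on V (Phi i)) (gV : C2_on V g).
Hypothesis surj :
  forall a : 'I_k -> K, exists v : 'cV[K]_n, forall i, 'd (Phi i) xb v = a i.
Hypothesis MV : forall y, V y -> (M y <-> forall i, Phi i y = 0).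
Hypothesis fg : forall y, V y -> M y -> f y = (g y)%:E.

Let F := constraint Phi.
Let DF := constraint_jac Phi.
Let B := DF xb.

Lemma manifold_constraint y : V y -> (M y <-> F y = 0).
Proof.
move=> Vy; split => [/(MV Vy) y0|/colP y0].
  by apply/colP => i; rewrite !mxE.
by apply/(MV Vy) => i; have := y0 i; rewrite !mxE.
Qed.

Lemma ball_domain : exists2 r : K, 0 < r & forall y, `|y - xb| < r -> V y.
Proof. by apply/nbhs_cvP; exact: open_nbhs_nbhs. Qed.

(** Points are moved onto [M] along the range of [A]. The bound by [F p] serves displacements along
    tangent vectors, where [F] is of smaller order; the other one keeps the new point near [xb]. *)
Lemma manifold_projection : exists A (C d : K), [/\ B *m A = 1%:M, 0 < C, 0 < d &
  forall p, `|p - xb| < d -> exists s, [/\ V (p + A *m s), M (p + A *m s),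
    `|A *m s| <= C * `|F p| & `|A *m s| <= C * `|p - xb| ]].
Proof.
have [A BA] := constraint_jac_right_inverse surj.
have sF := constraint_strict_diff oV Vxb PhiV.
have Fxb : F xb = 0 by apply/(manifold_constraint Vxb).
have [d1 d10 reg] := metric_regularity sF Fxb BA.
have [D [d2 [D0 d20 FD]]] := strict_diff_lipschitz sF.
have [CA CA0 AC] := mulmx_norm_bound A; have [r r0 rV] := ball_domain.
pose C := 2 * CA * (1 + D).
have C0 : 0 < C by rewrite !mulr_gt0// addr_gt0.
exists A, C, (Num.min (Num.min d1 d2) (r / (1 + C))); split => //.
  by rewrite !lt_min d10 d20 divr_gt0// addr_gt0.
move=> p; rewrite !lt_min => /andP[/andP[pd1 pd2] pr].
have [s [Fs sF2]] := reg p pd1.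
have Fp : `|F p| <= D * `|p - xb|.
  have := FD p xb pd2; rewrite subrr normr0 -[constraint Phi xb]/(F xb) Fxb subr0.
  exact.
have As : `|A *m s| <= 2 * CA * `|F p|.
  apply: (le_trans (AC s)); rewrite [2 * CA]mulrC -mulrA ler_wpM2l// ltW//.
have CF : 2 * CA * `|F p| <= C * `|F p|.
  by rewrite ler_wpM2r// ler_peMr ?mulr_ge0 ?ltW// ltrDl.
have Asp : `|A *m s| <= C * `|p - xb|.
  apply: (le_trans As); rewrite /C -[leRHS]mulrA.
  apply: ler_wpM2l; first by rewrite mulr_ge0// ltW.
  by apply: (le_trans Fp); rewrite ler_wpM2r// lerDr.
have Vs : V (p + A *m s).
  apply: rV; rewrite addrAC; apply: (le_lt_trans (ler_normD _ _)).
  by move: pr; rewrite ltr_pdivlMr ?addr_gt0//; lra.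
exists s; split => //; first exact/(manifold_constraint Vs).
exact: le_trans As CF.
Qed.

(** For [v] tangent at [x], the point [x + t v] is pushed back onto [M] at a cost of order [e t].
    The subgradient inequality there, compared with the expansion of [g], forces [dotp G v <= 0],
    and [- v] gives the reverse. *)
Lemma normal_multiplier : exists2 d : K, 0 < d & forall x u,
  `|x - xb| < d -> M x -> subdiff f x u ->
  exists l : 'cV[K]_k, u - grad g x = \sum_i l i 0 *: grad (Phi i) x.
Proof.
have [A [C [d0 [BA C0 d00 proj]]]] := manifold_projection.
have [r r0 rV] := ball_domain.
exists (Num.min r d0) => [|x u]; first by rewrite lt_min r0.
rewrite lt_min => /andP[xr xd0] Mx fxu; have Vx := rV x xr.
set G := u - grad g x.
suff half v : DF x *m v = 0 -> dotp G v <= 0.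
  have [v DFv|l ->] := @orthogonal_ker_range _ _ _ (DF x) G.
    apply/eqP; rewrite eq_le half//= -oppr_le0 -dotpNr half//.
    by rewrite mulmxN DFv oppr0.
  by exists l; rewrite constraint_jac_tr.
move=> DFv; rewrite leNgt; apply/negP => P0; set P := dotp G v in P0.
(* The total error per unit of [e t]. The choice of [e] gives [e * Kc < P], against the final
   [t * P <= t * (e * Kc)]. *)
pose Kc := (1 + C) * `|v| + n%:R * `|G| * (C * `|v|).
have Kc0 : 0 <= Kc by rewrite addr_ge0// !mulr_ge0// ?addr_ge0// ltW.
pose e := Num.min 1 (P / (2 * (Kc + 1))).
have Kc1 : 0 < 2 * (Kc + 1) by rewrite mulr_gt0// ltr_wpDl.
have e0 : 0 < e by rewrite lt_min ltr01 divr_gt0.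
have e1 : e <= 1 by rewrite ge_min lexx.
have eP : e * (2 * (Kc + 1)) <= P by rewrite -ler_pdivlMr// ge_min lexx orbT.
have [d1 d10 sF] := constraint_strict_diff oV Vx PhiV e0.
have [/(_ e e0)[d2 d20 sg] _] := C2_on_strict_diff oV Vx gV.
pose mu := Num.min (Num.min d1 d2) (d0 - `|x - xb|).
have mu0 : 0 < mu by rewrite !lt_min d10 d20 subr_gt0.
have v1 : 0 < 1 + `|v| by rewrite ltr_pwDl.
have C1 : 0 < 1 + C by rewrite addr_gt0.
(* The corrected point lies within [(1 + C) * t * |v| < mu] of [x]. *)
pose t := mu / ((1 + C) * (1 + `|v|)).
have t0 : 0 < t by rewrite divr_gt0// mulr_gt0.
have tE : t * ((1 + C) * (1 + `|v|)) = mu by rewrite divfK// gt_eqF// mulr_gt0.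
have tau0 : 0 <= t * `|v| by rewrite mulr_ge0// ltW.
have tauC : (1 + C) * (t * `|v|) < mu.
  by rewrite -tE; have := mulr_gt0 t0 C1; lra.
have tau : t * `|v| < mu.
  by apply: le_lt_trans tauC; rewrite ler_peMl// lerDl ltW.
have ntv : `|t *: v| = t * `|v| by rewrite normrZ gtr0_norm.
have [mu1 mu2 mu3] : [/\ mu <= d1, mu <= d2 & mu <= d0 - `|x - xb| ].
  by rewrite !ge_min !lexx !orbT.
have pd0 : `|x + t *: v - xb| < d0.
  rewrite addrAC; apply: (le_lt_trans (ler_normD _ _)); rewrite ntv; lra.
have [s [Vz Mz As _]] := proj _ pd0.
have Fp : `|F (x + t *: v)| <= e * (t * `|v|).
  have := sF (x + t *: v) x; rewrite addrAC subrr add0r normr0 ntv.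
  rewrite -scalemxAr -[constraint_jac Phi x]/(DF x) DFv scaler0 subr0.
  rewrite -[constraint Phi x]/(F x) (iffLR (manifold_constraint Vx) Mx) subr0; apply => //.
  exact: lt_le_trans tau mu1.
have {}As : `|A *m s| <= C * (e * (t * `|v|)).
  by apply: le_trans As _; rewrite ler_wpM2l// ltW.
have AsC : `|A *m s| <= C * (t * `|v|).
  by apply: le_trans As _; rewrite ler_wpM2l ?ler_piMl// ltW.
set z := x + t *: v + A *m s in Vz Mz.
have zx : z - x = t *: v + A *m s by rewrite /z addrAC [x + _ - x]addrAC subrr add0r.
have nzx : `|z - x| <= (1 + C) * (t * `|v|).
  by rewrite zx; apply: (le_trans (ler_normD _ _)); rewrite ntv; lra.
have := subdiff_le fxu (fg Vx Mx) (fg Vz Mz).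
have := sg z x (le_lt_trans nzx (lt_le_trans tauC mu2)).
rewrite subrr normr0 => /(_ d20)/(le_trans (ler_norm _)) h1 h2.
have h3 : dotp G (z - x) <= e * ((1 + C) * (t * `|v|)).
  rewrite /G dotpDl dotpNl.
  by have := ler_wpM2l (ltW e0) nzx; lra.
have h4 : - (n%:R * `|G| * (C * (e * (t * `|v|)))) <= dotp G (A *m s).
  rewrite lerNl; apply: (le_trans (ler_norm _)); rewrite normrN.
  by apply: (le_trans (dotp_norm_le _ _)); rewrite ler_wpM2l ?mulr_ge0.
have h5 : t * P <= t * (e * Kc).
  move: h3 h4; rewrite zx dotpDr dotpZr -/P /Kc.
  by move: (n%:R) => N; lra.
move: h5; rewrite ler_pM2l//; move: eP e0; lra.
Qed.

(** [F] vanishes along the curve, so [B *m (c h - xb) = o(h)]; divide by [h]. *)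
Lemma tangent_space_ker v : tangent_space M xb v -> B *m v = 0.
Proof.
move=> [c [c0 Mc dc]].
have sF := constraint_strict_diff oV Vxb PhiV.
have [CB CB0 BC] := mulmx_norm_bound B.
have [r r0 rV] := ball_domain.
apply/eqP; rewrite -normr_le0 leNgt; apply/negP => Bv.
pose Kc := CB + `|v| + 1.
have Kc0 : 0 < Kc by rewrite ltr_wpDl// addr_ge0// ltW.
pose e := Num.min 1 (`|B *m v| / (2 * Kc)).
have e0 : 0 < e by rewrite lt_min ltr01 divr_gt0// mulr_gt0.
have e1 : e <= 1 by rewrite ge_min lexx.
have eB : e * (2 * Kc) <= `|B *m v|.
  by rewrite -ler_pdivlMr ?mulr_gt0// ge_min lexx orbT.
have [d d0 dP] := sF e e0.
have [h [h0 hs Mh qh]] : exists h : K, [/\ h != 0, `|h| * (`|v| + 1) < Num.min r d,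
    M (c h) & `|h^-1 *: (c h - xb) - v| < e ].
  have /cvgrPdistC_lt/(_ e e0) dv : h^-1 *: ((c \o shift 0) (h *: 1) - c 0) @[h --> 0^'] --> v.
    by have [dd <-] := dc; exact: dd.
  have m0 : 0 < Num.min r d / (`|v| + 1) by rewrite divr_gt0 ?ltr_wpDl// lt_min r0.
  have nr : \forall h \near 0^', [/\ h != 0, `|h| < Num.min r d / (`|v| + 1),
      M (c h) & `|h^-1 *: ((c \o shift 0) (h *: 1) - c 0) - v| < e].
    near=> h; split.
    - by near: h; exact: nbhs_dnbhs_neq.
    - by near: h; exact: dnbhs0_lt.
    - by near: h; exact: nbhs_dnbhs.
    - by near: h.
  have [h [h0 hr Mh hv]] := @filter_ex _ _ (Proper_dnbhs_numFieldType 0) _ nr.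
  exists h; split => //; first by rewrite -ltr_pdivlMr// ltr_wpDl.
  by move: hv; rewrite /= addr0 c0 [h *: 1]mulr1.
set q := h^-1 *: (c h - xb) in qh.
have chE : c h - xb = h *: q by rewrite /q scalerA mulfV// scale1r.
clearbody q; have qv : `|q| <= `|v| + e.
  by have := ler_normD (q - v) v; rewrite subrK; lra.
have nch : `|c h - xb| < Num.min r d.
  apply: le_lt_trans hs; rewrite chE normrZ ler_wpM2l//; lra.
move: nch; rewrite lt_min => /andP[chr chd].
have := dP (c h) xb chd; rewrite subrr normr0 => /(_ d0).
rewrite -[constraint Phi xb]/(F xb) -[constraint Phi (c h)]/(F (c h)).
rewrite (iffLR (manifold_constraint Vxb) Mxb) (iffLR (manifold_constraint (rV _ chr)) Mh).
rewrite !subr0 sub0r normrN chE -scalemxAr !normrZ mulrCA ler_pM2l ?normr_gt0// => Bq.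
have := BC (v - q); rewrite mulmxBr [`|v - q|]distrC => h1.
have := ler_normD (B *m v - B *m q) (B *m q); rewrite subrK.
have : CB * `|q - v| <= CB * e by rewrite ler_wpM2l// ltW.
have qv1 : `|q| <= `|v| + 1 by lra.
have := ler_wpM2l (ltW e0) qv1.
move: eB; rewrite /Kc; move: Bq; rewrite -[constraint_jac Phi xb]/B.
have := mulr_gt0 e0 CB0; have := mulr_ge0 (ltW e0) (normr_ge0 v).
move: h1; lra.
Unshelve. all: by end_near.
Qed.

Hypothesis sharp : tangent_space M xb = orthoc (par (subdiff f xb)).
Hypothesis nondeg : ri (subdiff f xb) ub.
Hypothesis cont : sv_continuous_rel (subdiff f) M xb.

(** By sharpness the orthogonal of [par] is the tangent space, hence inside the kernel of [B], whose
    rows are these gradients. *)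
Lemma grad_constraint_par i : orthoc (orthoc (par (subdiff f xb))) (grad (Phi i) xb).
Proof.
rewrite -sharp => v /tangent_space_ker/colP/(_ i).
by rewrite constraint_jac_coord mxE dotpC.
Qed.

(* Let y = x + A s be a point of M close to x, so that B (y - x) = s.  Near the
   subgradients ub +- d (grad Phi_i) at xb there are subgradients at y, and
   monotonicity of the subdifferential makes B (y - x) small w.r.t. s. *)
Lemma identification : exists2 d : K, 0 < d & forall x u,
  `|x - xb| < d -> `|u - ub| < d -> subdiff f x u -> M x.
Proof.
have [A [C [d0 [BA C0 d00 proj]]]] := manifold_projection.
have [CA CA0 AC] := mulmx_norm_bound A.
have [dl dl0 dlP] := ri_perturbation nondeg grad_constraint_par.
(* [u] and the subgradient at [y] contribute an error [eta] each; this value keeps the total effect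
   on [s] at most [dl / 2 * |s|]. *)
pose eta := dl / (4 * (n%:R + 1) * CA).
have eta0 : 0 < eta by rewrite divr_gt0// !mulr_gt0// ltr_wpDl.
have ne : n%:R * (2 * eta) * CA <= dl / 2.
  have -> : n%:R * (2 * eta) * CA = dl / 2 * (n%:R / (n%:R + 1)).
    by rewrite /eta; field; rewrite !gt_eqF// ltr_wpDl.
  by rewrite ler_piMr ?divr_ge0 ?ltW// ?ltr_pdivrMr ?mul1r ?ltrDl// ltr_wpDl.
have nn0 : 0 <= n%:R * (2 * eta).
  exact: mulr_ge0 (ler0n _ _) (mulr_ge0 (ler0n _ 2) (ltW eta0)).
clearbody eta.
have [_ lsc] := cont.
have pert i (t : K) : `|t| <= dl -> exists2 d : K, 0 < d & forall y, `|y - xb| < d -> M y ->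
    exists2 s, subdiff f y s & `|s - (ub + t *: grad (Phi i) xb)| < eta.
  move=> tdl; have := lsc _ (dlP i t tdl) (ball (ub + t *: grad (Phi i) xb) eta).
  move=> /(_ (nbhsx_ballx _ _ eta0)) /nbhs_cvP[d dpos dP].
  exists d => // y yd My; have [s [fys]] := dP y yd My.
  by rewrite -ball_normE /= distrC => h; exists s.
have [||d1 d10 d1P] := @common_radius _ k (fun i d => forall (b : bool) y, `|y - xb| < d -> M y ->
    exists2 s, subdiff f y s & `|s - (ub + ((-1) ^+ b * dl) *: grad (Phi i) xb)| < eta).
- move=> i; have [|da da0 daP] := pert i ((-1) ^+ true * dl).
    by rewrite normrMsign ger0_norm// ltW.
  have [|db db0 dbP] := pert i ((-1) ^+ false * dl).
    by rewrite normrMsign ger0_norm// ltW.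
  exists (Num.min da db) => [|b y]; first by rewrite lt_min da0.
  by rewrite lt_min => /andP[ya yb]; case: b; [exact: daP|exact: dbP].
- move=> i d d' dd' H b y yd; apply: H; exact: lt_le_trans yd dd'.
pose d := Num.min (Num.min d0 eta) (d1 / (1 + C)).
have C1 : 0 < 1 + C by rewrite addr_gt0.
exists d => [|x u]; first by rewrite !lt_min d00 eta0 divr_gt0.
rewrite !lt_min => /andP[/andP[xd0 _] xd1] /andP[/andP[_ ue] _] fxu.
have [s [Vy My _ As]] := proj x xd0; set y := x + A *m s in Vy My.
have yd1 : `|y - xb| < d1.
  rewrite /y addrAC; apply: (le_lt_trans (ler_normD _ _)).
  by move: xd1; rewrite ltr_pdivlMr//; lra.
have xy : x - y = - (A *m s) by rewrite /y opprD addrA subrr add0r.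
suff s0 : s = 0 by move: My; rewrite /y s0 mulmx0 addr0.
(* [u - v] is close to [- t grad (Phi i) xb] and [x - y = - A s], so by [B A = 1] monotonicity reads
   [0 <= error + t * s i 0]. The two signs of [t] give [dl * |s| <= dl / 2 * |s|]. *)
have key i (b : bool) : 0 <= n%:R * (2 * eta) * (CA * `|s|) + (-1) ^+ b * dl * s i 0.
  have [v fyv vE] := d1P i b y yd1 My.
  have := subdiff_monotone pf fxu fyv; rewrite xy.
  set t := (-1) ^+ b * dl in vE *.
  have -> : u - v = - (v - (ub + t *: grad (Phi i) xb) - (u - ub)) - t *: grad (Phi i) xb.
    by apply/matrixP => a c; rewrite !mxE; ring.
  move: vE; set w0 := v - _ => vE.
  have wE : `|w0 - (u - ub)| <= 2 * eta.
    by apply: (le_trans (ler_normB _ _)); move: vE ue; lra.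
  move: (w0 - (u - ub)) wE => w wE.
  rewrite dotpNr dotpDl !dotpNl dotpZl -constraint_jac_coord mulmxA.
  rewrite -[constraint_jac Phi xb]/B BA mul1mx => h.
  have := ler_norm (dotp w (A *m s)); have := dotp_norm_le w (A *m s).
  have : n%:R * `|w| * `|A *m s| <= n%:R * (2 * eta) * (CA * `|s|).
    by rewrite ler_pM ?mulr_ge0// ?ler_wpM2l.
  by move: h; move: (n%:R) (t * _) => N q; lra.
have sE : dl * `|s| <= n%:R * (2 * eta) * (CA * `|s|).
  have [->|s_neq0] := eqVneq s 0; first by rewrite normr0 !mulr0.
  rewrite mulrC -ler_pdivlMr//; apply/cv_norm_le => [|i].
    exact: divr_ge0 (mulr_ge0 nn0 (mulr_ge0 (ltW CA0) (normr_ge0 _))) (ltW dl0).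
  rewrite ler_pdivlMr// mulrC -{1}(ger0_norm (ltW dl0)) -normrM ler_norml.
  have := key i true; have := key i false.
  rewrite expr0 expr1 mul1r mulN1r mulNr => k1 k2.
  by apply/andP; split; move: k1 k2; move: (_ * (CA * _)) (dl * _) => p q; lra.
have h : n%:R * (2 * eta) * (CA * `|s|) <= dl / 2 * `|s|.
  by rewrite mulrA ler_wpM2r.
apply/eqP; rewrite -normr_le0 -(pmulr_rle0 _ dl0); move: h sE.
by move: (n%:R * _ * _) => p; lra.
Qed.

Definition lagrangian_hess (l : 'cV[K]_k) : 'M[K]_n :=
  hess g xb + \sum_i l i 0 *: hess (Phi i) xb.

Lemma dotp_suml (I : finType) (v : I -> 'cV[K]_n) w :
  dotp (\sum_i v i) w = \sum_i dotp (v i) w.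
Proof.
apply: (big_ind2 (fun a b => dotp a w = b)) => //; first exact: dotp0l.
by move=> a b c e ab ce; rewrite dotpDl ab ce.
Qed.

Lemma lagrangian_hess_mulmx l (v : 'cV[K]_n) : lagrangian_hess l *m v =
  hess g xb *m v + \sum_i l i 0 *: (hess (Phi i) xb *m v).
Proof.
rewrite mulmxDl mulmx_suml; congr (_ + _); apply: eq_bigr => i _.
by rewrite scalemxAl.
Qed.

(** On [M] the constraints vanish, so [f] equals the Lagrangian there; by the choice of [l] the
    first-order terms cancel in the subgradient inequality at [xb]. *)
Lemma lagrangian_second_order (l : 'cV[K]_k) :
  ub - grad g xb = \sum_i l i 0 *: grad (Phi i) xb ->
  forall e : K, 0 < e -> exists2 d : K, 0 < d & forall y, `|y - xb| < d -> M y ->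
    0 <= dotp (lagrangian_hess l *m (y - xb)) (y - xb) + e * `|y - xb| ^+ 2.
Proof.
move=> lE e e0; pose c := 2 * (1 + k%:R * `|l|).
have c0 : 0 < c by rewrite mulr_gt0// ltr_pwDl// mulr_ge0.
pose e' := e / c; have e'0 : 0 < e' by rewrite divr_gt0.
have e'c : e' * c = e by rewrite divfK// gt_eqF.
have [r r0 rV] := ball_domain.
have [d1 d10 Tg] := taylor2 oV Vxb gV e'0.
have [||d2 d20 TPhi] := @common_radius _ k (fun i d => forall v : 'cV[K]_n, `|v| < d ->
   `|Phi i (xb + v) - Phi i xb - dotp (grad (Phi i) xb) v -
     2^-1 * dotp (hess (Phi i) xb *m v) v| <= e' * `|v| ^+ 2).
- by move=> i; exact: taylor2 oV Vxb (PhiV i) _ e'0.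
- by move=> i d d' dd' H v vd; apply: H; exact: lt_le_trans vd dd'.
exists (Num.min r (Num.min d1 d2)) => [|y]; first by rewrite !lt_min r0 d10.
rewrite !lt_min => /and3P[yr yd1 yd2] My; have Vy := rV y yr.
have yE : xb + (y - xb) = y by rewrite addrC subrK.
have := Tg _ yd1; rewrite yE => /(le_trans (ler_norm _)).
have := subdiff_le fub (fg Vxb Mxb) (fg Vy My).
have Ti i := TPhi i _ yd2; move: Ti; rewrite yE.
set w := y - xb => Ti; set nw := `|w| ^+ 2 => h1 h2.
have nw0 : 0 <= nw by exact: sqr_ge0.
have hl : 0 <= \sum_i l i 0 * (dotp (grad (Phi i) xb) w +
    2^-1 * dotp (hess (Phi i) xb *m w) w) + k%:R * (`|l| * (e' * nw)).
  have -> : k%:R * (`|l| * (e' * nw)) = \sum_(i < k) `|l| * (e' * nw).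
    by rewrite sumr_const card_ord mulr_natl.
  rewrite -big_split; apply: sumr_ge0 => i _ /=.
  have := Ti i; rewrite (iffLR (MV Vxb) Mxb i) (iffLR (MV Vy) My i) subrr add0r.
  rewrite -opprD normrN; set a := _ + _ => ha.
  have : `|l i 0 * a| <= `|l| * (e' * nw) by rewrite normrM ler_pM// cv_norm_coord.
  by rewrite ler_norml => /andP[+ _]; lra.
have uE : dotp ub w = dotp (grad g xb) w + \sum_i l i 0 * dotp (grad (Phi i) xb) w.
  rewrite -[ub](subrK (grad g xb)) lE dotpDl addrC dotp_suml; congr (_ + _).
  by apply: eq_bigr => i _; rewrite dotpZl.
have HE : dotp (lagrangian_hess l *m w) w = dotp (hess g xb *m w) w +
    \sum_i l i 0 * dotp (hess (Phi i) xb *m w) w.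
  rewrite lagrangian_hess_mulmx dotpDl dotp_suml; congr (_ + _).
  by apply: eq_bigr => i _; rewrite dotpZl.
have sE : \sum_i l i 0 * (dotp (grad (Phi i) xb) w +
    2^-1 * dotp (hess (Phi i) xb *m w) w) =
    \sum_i l i 0 * dotp (grad (Phi i) xb) w +
    2^-1 * \sum_i l i 0 * dotp (hess (Phi i) xb *m w) w.
  by rewrite mulr_sumr -big_split; apply: eq_bigr => i _ /=; ring.
move: hl h1 h2; rewrite HE sE uE -e'c /c.
move: (\sum_i _) (\sum_i _) (k%:R) => s1 s2 N; lra.
Qed.

(** The second-order inequality is known only on [M], so [v] is approximated by
    [(z - xb) / t = v + q] with [z] in [M] and [q] of order [e]. *)
Lemma lagrangian_hess_psd (l : 'cV[K]_k) :
  ub - grad g xb = \sum_i l i 0 *: grad (Phi i) xb ->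
  forall v : 'cV[K]_n, B *m v = 0 -> 0 <= dotp (lagrangian_hess l *m v) v.
Proof.
move=> lE v Bv; have so := lagrangian_second_order lE.
rewrite leNgt; apply/negP => Q0.
have [A [C [d0 [BA C0 d00 proj]]]] := manifold_projection.
have [h h0 hP] := mulmx_norm_bound (lagrangian_hess l).
set H := lagrangian_hess l in so Q0 hP; set Q := dotp (H *m v) v in Q0.
(* Collects the bounds [b1] to [b4] below, divided by [e]. *)
pose Kc := n%:R * h * (2 * C + C ^+ 2) * `|v| ^+ 2 + (1 + C) ^+ 2 * `|v| ^+ 2.
have Kc0 : 0 <= Kc.
  have C20 : 0 <= 2 * C + C ^+ 2 by have := sqr_ge0 C; lra.
  have nh0 : 0 <= n%:R * h by rewrite mulr_ge0// ltW.
  exact: addr_ge0 (mulr_ge0 (mulr_ge0 nh0 C20) (sqr_ge0 _)) (mulr_ge0 (sqr_ge0 _) (sqr_ge0 _)).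
pose e := Num.min 1 (- Q / (2 * (Kc + 1))).
have Kc1 : 0 < 2 * (Kc + 1) by rewrite mulr_gt0// ltr_wpDl.
have e0 : 0 < e by rewrite lt_min ltr01 divr_gt0// oppr_gt0.
have e1 : e <= 1 by rewrite ge_min lexx.
have eQ : e * (2 * (Kc + 1)) <= - Q by rewrite -ler_pdivlMr// ge_min lexx orbT.
have [d1 d10 d1P] := so e e0.
have [d2 d20 sF] := constraint_strict_diff oV Vxb PhiV e0.
pose mu := Num.min (Num.min d1 d2) d0.
have mu0 : 0 < mu by rewrite !lt_min d10 d20.
have [mu1 mu2 mu3] : [/\ mu <= d1, mu <= d2 & mu <= d0] by rewrite !ge_min !lexx !orbT.
have v1 : 0 < 1 + `|v| by rewrite ltr_pwDl.
have C1 : 0 < 1 + C by rewrite addr_gt0.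
pose t := mu / ((1 + C) * (1 + `|v|)).
have t0 : 0 < t by rewrite divr_gt0// mulr_gt0.
have tE : t * ((1 + C) * (1 + `|v|)) = mu by rewrite divfK// gt_eqF// mulr_gt0.
have tauC : (1 + C) * (t * `|v|) < mu.
  by rewrite -tE; have := mulr_gt0 t0 C1; lra.
have tau : t * `|v| < mu.
  have tau0 : 0 <= t * `|v| := mulr_ge0 (ltW t0) (normr_ge0 v).
  by apply: le_lt_trans tauC; have := mulr_ge0 (ltW C0) tau0; lra.
have ntv : `|t *: v| = t * `|v| by rewrite normrZ gtr0_norm.
have pE : xb + t *: v - xb = t *: v by rewrite addrAC subrr add0r.
have pd : `|xb + t *: v - xb| < mu by rewrite pE ntv.
have [s [Vz Mz As _]] := proj _ (lt_le_trans pd mu3).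
have Fp : `|F (xb + t *: v)| <= e * (t * `|v|).
  have := sF (xb + t *: v) xb (lt_le_trans pd mu2); rewrite subrr normr0 pE ntv.
  rewrite -scalemxAr -[constraint_jac Phi xb]/B Bv scaler0 subr0.
  by rewrite -[constraint Phi xb]/(F xb) (iffLR (manifold_constraint Vxb) Mxb) subr0; apply.
have {}As : `|A *m s| <= C * (e * (t * `|v|)).
  by apply: le_trans As _; rewrite ler_wpM2l// ltW.
pose q := t^-1 *: (A *m s).
have AsE : A *m s = t *: q by rewrite /q scalerA mulfV ?scale1r// gt_eqF.
clearbody q.
have qe : `|q| <= C * e * `|v|.
  by rewrite -(ler_pM2l t0); move: As; rewrite AsE normrZ gtr0_norm//; lra.
have qC : `|q| <= C * `|v|.
  by apply: le_trans qe _; rewrite ler_wpM2r// ler_piMr// ltW.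
have zE : xb + t *: v + A *m s - xb = t *: (v + q).
  by rewrite AsE scalerDr addrAC pE.
have vq : `|v + q| <= (1 + C) * `|v|.
  by apply: (le_trans (ler_normD _ _)); lra.
have zd : `|xb + t *: v + A *m s - xb| < d1.
  rewrite zE normrZ gtr0_norm//; apply: le_lt_trans (lt_le_trans tauC mu1).
  by rewrite mulrCA ler_pM2l.
have := d1P _ zd Mz; rewrite zE -scalemxAr dotpZl dotpZr normrZ exprMn.
rewrite (gtr0_norm t0) => hh.
have {}hh : 0 <= dotp (H *m (v + q)) (v + q) + e * `|v + q| ^+ 2.
  have t2 : 0 < t * t by rewrite mulr_gt0.
  by rewrite -(pmulr_rge0 _ t2); move: hh; rewrite [t ^+ 2]expr2; lra.
have bil a b s1 s2 : `|a| <= s1 -> `|b| <= s2 -> dotp (H *m a) b <= n%:R * h * (s1 * s2).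
  move=> as1 bs2; apply: (le_trans (ler_norm _)); apply: (le_trans (dotp_norm_le _ _)).
  rewrite -!mulrA ler_wpM2l// mulrA ler_pM// ?mulr_ge0 ?normr_ge0//.
  by apply: (le_trans (hP a)); rewrite ler_wpM2l// ltW.
have b1 := bil v q _ _ (lexx _) qe.
have b2 := bil q v _ _ qe (lexx _).
have b3 := bil q q _ _ qe qC.
have b4 : e * `|v + q| ^+ 2 <= e * ((1 + C) ^+ 2 * `|v| ^+ 2).
  by rewrite ler_pM2l// -exprMn ler_pXn2r// nnegrE// mulr_ge0// ltW.
move: hh; rewrite mulmxDr dotpDl !dotpDr -/Q => hh.
have : 0 <= Q + e * Kc.
  by rewrite /Kc; move: b1 b2 b3 b4 hh; move: (n%:R) (`|v|) => N a; lra.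
by move: eQ e0; lra.
Qed.

Lemma grad_family_lipschitz : exists2 C : K, 0 < C & exists2 d : K, 0 < d &
  forall i x x', `|x - xb| < d -> `|x' - xb| < d ->
    `|grad (Phi i) x' - grad (Phi i) x| <= C * `|x' - x| /\
    `|hess (Phi i) xb *m (x' - x)| <= C * `|x' - x|.
Proof.
have [H H0 HP] : exists2 C, 0 < C & forall i, forall v : 'cV[K]_n,
    `|hess (Phi i) xb *m v| <= C * `|v|.
  apply: common_bound => [i|i C C' CC' h v]; first exact: mulmx_norm_bound.
  by apply: (le_trans (h v)); rewrite ler_wpM2r.
have [d d0 dP] := grad_strict_diff_family oV Vxb PhiV ltr01.
exists (1 + H); first by rewrite addr_gt0.
exists d => // i x x' xd xd'; have := HP i (x' - x) => h; split; last first.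
  by apply: (le_trans h); rewrite ler_wpM2r// lerDr.
have := dP i x' x xd' xd; rewrite mul1r => h2.
have := ler_normD (grad (Phi i) x' - grad (Phi i) x - hess (Phi i) xb *m (x' - x))
  (hess (Phi i) xb *m (x' - x)).
by rewrite subrK; lra.
Qed.

(** [A^T] recovers multipliers from normal vectors at [xb]. Using the gradients at [x'] instead
    costs [S1], a small multiple of [l' - l] that is absorbed on the left. *)
Lemma multiplier_lipschitz : exists2 C : K, 0 < C & exists2 d : K, 0 < d &
  forall x x' u u' (l l' : 'cV[K]_k), `|x - xb| < d -> `|x' - xb| < d ->
    u - grad g x = \sum_i l i 0 *: grad (Phi i) x ->
    u' - grad g x' = \sum_i l' i 0 *: grad (Phi i) x' ->
    `|l' - l| <= C * (`|u' - u| + (1 + `|l|) * `|x' - x|).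
Proof.
have [A BA] := constraint_jac_right_inverse surj.
have [CA CA0 AC] := mulmx_norm_bound A^T.
have [N N0 [d1 d10 NP]] := grad_family_lipschitz.
have [_ sg] := C2_on_strict_diff oV Vxb gV.
have [G [d2 [G0 d20 GP]]] := strict_diff_lipschitz sg.
pose m := CA * (k%:R * N); have m0 : 0 <= m by rewrite !mulr_ge0// ltW.
have m1 : 0 < 2 * m + 1 by rewrite ltr_wpDl// mulr_ge0.
pose C := 2 * CA * (1 + G + k%:R * N).
have kN : 0 <= k%:R * N by rewrite mulr_ge0// ltW.
exists C; first by rewrite !mulr_gt0// ltr_wpDr// addr_gt0.
(* The last radius gives [m * |x' - xb| <= 1/2], the factor with which [S1] is absorbed. *)
exists (Num.min (Num.min d1 d2) (2 * m + 1)^-1).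
  by rewrite !lt_min d10 d20 invr_gt0.
move=> x x' u u' l l'; rewrite !lt_min => /andP[/andP[xd1 xd2] _].
move=> /andP[/andP[xd1' xd2'] xm'] lE lE'.
pose S1 := \sum_i (l' - l) i 0 *: (grad (Phi i) x' - grad (Phi i) xb).
pose S2 := \sum_i l i 0 *: (grad (Phi i) x' - grad (Phi i) x).
have xbd : `|xb - xb| < d1 by rewrite subrr normr0.
have key : l' - l = A^T *m ((u' - u) - (grad g x' - grad g x) - S2) - A^T *m S1.
  have -> : l' - l = A^T *m (\sum_i (l' - l) i 0 *: grad (Phi i) xb).
    by rewrite -constraint_jac_tr mulmxA -trmx_mul BA trmx1 mul1mx.
  rewrite -mulmxBr; congr (_ *m _).
  have -> : (u' - u) - (grad g x' - grad g x) = (u' - grad g x') - (u - grad g x).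
    by apply/matrixP => i j; rewrite !mxE; ring.
  rewrite lE lE' /S1 /S2 -!sumrB; apply: eq_bigr => i _.
  by apply/matrixP => a b; rewrite !mxE; ring.
have S1E : `|S1| <= k%:R * `|l' - l| * (N * `|x' - xb|).
  apply: norm_sum_scale => i; first exact: cv_norm_coord.
  by have [] := NP i xb x' xbd xd1'.
have S2E : `|S2| <= k%:R * `|l| * (N * `|x' - x|).
  apply: norm_sum_scale => i; first exact: cv_norm_coord.
  by have [] := NP i x x' xd1 xd1'.
have gE := GP x' x xd2' xd2.
have hA1 : `|A^T *m S1| <= 2^-1 * `|l' - l|.
  apply: (le_trans (AC S1)); apply: (le_trans (ler_wpM2l (ltW CA0) S1E)).
  have -> : CA * (k%:R * `|l' - l| * (N * `|x' - xb|)) = m * `|x' - xb| * `|l' - l|.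
    by rewrite /m; ring.
  apply: ler_wpM2r => //.
  have := ler_wpM2l m0 (ltW xm').
  have : m * (2 * m + 1)^-1 <= 2^-1 by rewrite ler_pdivrMr//; lra.
  lra.
have hA2 : `|A^T *m ((u' - u) - (grad g x' - grad g x) - S2)| <=
    CA * (`|u' - u| + G * `|x' - x| + k%:R * `|l| * (N * `|x' - x|)).
  apply: (le_trans (AC _)); rewrite ler_wpM2l ?(ltW CA0)//.
  apply: (le_trans (ler_normB _ _)); rewrite lerD//.
  by apply: (le_trans (ler_normB _ _)); rewrite lerD.
have := ler_normB (A^T *m ((u' - u) - (grad g x' - grad g x) - S2)) (A^T *m S1).
rewrite -key => h.
have : `|l' - l| <= 2 * CA * (`|u' - u| + G * `|x' - x| + k%:R * `|l| * (N * `|x' - x|)).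
  rewrite -[leRHS]mulrA; move: h hA1 hA2.
  move: (CA * (_ + _)) (`|_ *m S1|) (`|_ *m (_ - S2)|) (`|l' - l|) => a b c p; lra.
move/le_trans; apply; rewrite /C -[leRHS]mulrA ler_wpM2l ?mulr_ge0 ?(ltW CA0)//.
have p1 : 0 <= `|u' - u| by [].
have p2 : 0 <= `|x' - x| by [].
have p3 : 0 <= `|l| by [].
have q1 := mulr_ge0 (ltW G0) p1; have q2 := mulr_ge0 kN p1.
have q3 := mulr_ge0 (ltW G0) (mulr_ge0 p3 p2); have q4 := mulr_ge0 kN p2.
have q5 := mulr_ge0 p3 p2.
move: q1 q2 q3 q4 q5 p1 p2 p3; move: (`|u' - u|) (`|x' - x|) (`|l|) (k%:R) => a b c p; lra.
Qed.

Lemma constraint_increment e : 0 < e -> exists2 d : K, 0 < d & forall x x',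
  `|x - xb| < d -> `|x' - xb| < d -> M x -> M x' -> `|B *m (x' - x)| <= e * `|x' - x|.
Proof.
move=> e0; have [d d0 dP] := constraint_strict_diff oV Vxb PhiV e0.
have [r r0 rV] := ball_domain; exists (Num.min r d) => [|x x'].
  by rewrite lt_min r0.
rewrite !lt_min => /andP[xr xd] /andP[xr' xd'] Mx Mx'.
have := dP x' x xd' xd.
rewrite -[constraint Phi x']/(F x') -[constraint Phi x]/(F x).
rewrite (iffLR (manifold_constraint (rV _ xr)) Mx) (iffLR (manifold_constraint (rV _ xr')) Mx').
by rewrite subrr sub0r normrN.
Qed.

(** [Q^T] annihilates the constraint gradients at [xb], and with them the leading effect of the
    change of multipliers, which need not be small against [u' - u]. The rest is a first-order
    remainder or carries a small factor. *)
Lemma projected_increment (lb : 'cV[K]_k) (Q : 'M[K]_n) :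
  ub - grad g xb = \sum_i lb i 0 *: grad (Phi i) xb -> B *m Q = 0 ->
  exists2 C : K, 0 < C & forall e, 0 < e <= 1 -> exists2 d : K, 0 < d &
    forall x x' u u', `|x - xb| < d -> `|x' - xb| < d ->
    `|u - ub| < d -> `|u' - ub| < d -> M x -> M x' ->
    subdiff f x u -> subdiff f x' u' ->
    `|Q^T *m ((u' - u) - lagrangian_hess lb *m (x' - x))|
      <= e * (C * (`|x' - x| + `|u' - u|)).
Proof.
move=> lbE BQ; have [CQ CQ0 QC] := mulmx_norm_bound Q^T.
have [N N0 [d1 d10 NP]] := grad_family_lipschitz.
have [Cl Cl0 [d2 d20 lP]] := multiplier_lipschitz.
have [d3 d30 multP] := normal_multiplier.
have [_ sg] := C2_on_strict_diff oV Vxb gV.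
pose c1 := 1 + k%:R * (`|lb| + 1) + k%:R * N.
pose c2 := k%:R * N * Cl * (2 + `|lb|).
have kN : 0 <= k%:R * N by rewrite mulr_ge0// ltW.
have c10 : 0 < c1 by rewrite ltr_wpDr// ltr_wpDr// mulr_ge0// addr_ge0.
have c20 : 0 <= c2 by rewrite !mulr_ge0 ?addr_ge0// ltW.
exists (CQ * (c1 + c2)); first by rewrite mulr_gt0// ltr_wpDr.
move=> e /andP[e0 e1].
have [d4 d40 gP] := sg e e0.
have [d5 d50 PP] := grad_strict_diff_family oV Vxb PhiV e0.
pose cl := Cl * (2 + `|lb|); have cl0 : 0 < cl by rewrite mulr_gt0// ltr_wpDr.
have [d6 d60 [d6e d6cl]] : exists2 d6, 0 < d6 & d6 <= e /\ cl * d6 <= e.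
  exists (Num.min e (e / cl)); first by rewrite lt_min e0 divr_gt0.
  split; first by rewrite ge_min lexx.
  by rewrite mulrC -ler_pdivlMr// ge_min lexx orbT.
pose d := Num.min (Num.min (Num.min d1 d2) (Num.min d3 d4)) (Num.min d5 d6).
have d0 : 0 < d by rewrite !lt_min d10 d20 d30 d40 d50 d60.
have [[dd1 dd2] [dd3 dd4] [dd5 dd6]] :
    [/\ d <= d1 /\ d <= d2, d <= d3 /\ d <= d4 & d <= d5 /\ d <= d6].
  by do !split; rewrite !ge_min lexx ?orbT.
exists d => // x x' u u' xd xd' ud ud' Mx Mx' fxu fxu'.
have [l lE] := multP x u (lt_le_trans xd dd3) Mx fxu.
have [l' lE'] := multP x' u' (lt_le_trans xd' dd3) Mx' fxu'.
have xbd2 : `|xb - xb| < d2 by rewrite subrr normr0.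
have xbd1 : `|xb - xb| < d1 by rewrite subrr normr0.
have lbl : `|l - lb| <= e.
  have := lP xb x ub u lb l xbd2 (lt_le_trans xd dd2) lbE lE.
  move/le_trans; apply.
  apply: le_trans d6cl; rewrite /cl -mulrA ler_wpM2l ?(ltW Cl0)//.
  have : (1 + `|lb|) * `|x - xb| <= (1 + `|lb|) * d6.
    by rewrite ler_wpM2l ?addr_ge0// ltW// (lt_le_trans xd dd6).
  by have := lt_le_trans ud dd6; lra.
have ln : `|l| <= `|lb| + 1.
  by have := ler_normD (l - lb) lb; rewrite subrK; lra.
have ll' : `|l' - l| <= Cl * (2 + `|lb|) * (`|x' - x| + `|u' - u|).
  have := lP x x' u u' l l' (lt_le_trans xd dd2) (lt_le_trans xd' dd2) lE lE'.
  move/le_trans; apply; rewrite -mulrA ler_wpM2l ?(ltW Cl0)//.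
  have p1 : 0 <= `|u' - u| by [].
  have p2 : 0 <= `|lb| by [].
  have := ler_wpM2r (normr_ge0 (x' - x)) ln; have := mulr_ge0 p2 p1.
  move: p1 p2; move: (`|u' - u|) (`|x' - x|) (`|l|) (`|lb|) => a b c p; lra.
(* [T1] and [T2] are gradient remainders, [T3] comes from the drift of [l] away from [lb], and [T4]
   from the gradients at [x'] not being those at [xb]. *)
pose T1 := grad g x' - grad g x - hess g xb *m (x' - x).
pose T2 := \sum_i l i 0 *: (grad (Phi i) x' - grad (Phi i) x - hess (Phi i) xb *m (x' - x)).
pose T3 := \sum_i (l - lb) i 0 *: (hess (Phi i) xb *m (x' - x)).
pose T4 := \sum_i (l' - l) i 0 *: (grad (Phi i) x' - grad (Phi i) xb).
have QN : Q^T *m (\sum_i (l' - l) i 0 *: grad (Phi i) xb) = 0.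
  by rewrite -constraint_jac_tr mulmxA -trmx_mul -[constraint_jac Phi xb]/B BQ trmx0 mul0mx.
have -> : Q^T *m ((u' - u) - lagrangian_hess lb *m (x' - x)) = Q^T *m (T1 + T2 + T3 + T4).
  rewrite -[LHS]subr0 -QN -mulmxBr lagrangian_hess_mulmx; congr (_ *m _).
  have -> : u' - u = (u' - grad g x') - (u - grad g x) + (grad g x' - grad g x).
    by apply/matrixP => i j; rewrite !mxE; ring.
  rewrite lE lE'.
  have hd i : (l' - l) i 0 = l' i 0 - l i 0 by rewrite !mxE.
  have hdb i : (l - lb) i 0 = l i 0 - lb i 0 by rewrite !mxE.
  have inc : \sum_i l' i 0 *: grad (Phi i) x' - \sum_i l i 0 *: grad (Phi i) x -
      \sum_i lb i 0 *: (hess (Phi i) xb *m (x' - x)) -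
      \sum_i (l' - l) i 0 *: grad (Phi i) xb = T2 + T3 + T4.
    exact: (sum_scale_increment _ _ _ _ hd hdb).
  have -> : T1 + T2 + T3 + T4 = T1 + (T2 + T3 + T4) by rewrite !addrA.
  rewrite -inc /T1.
  move: (\sum_i l' i 0 *: _) (\sum_i l i 0 *: _) (\sum_i lb i 0 *: _) => s1 s2 s3.
  move: (\sum_i (l' - l) i 0 *: _) => s4.
  by apply/matrixP => i j; rewrite !mxE; ring.
apply: (le_trans (QC _)).
have b1 : `|T1| <= e * `|x' - x|.
  exact: gP x' x (lt_le_trans xd' dd4) (lt_le_trans xd dd4).
have b2 : `|T2| <= k%:R * (`|lb| + 1) * (e * `|x' - x|).
  apply: norm_sum_scale => i; first exact: le_trans (cv_norm_coord _ _) ln.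
  exact: PP i x' x (lt_le_trans xd' dd5) (lt_le_trans xd dd5).
have b3 : `|T3| <= k%:R * e * (N * `|x' - x|).
  apply: norm_sum_scale => i; first exact: le_trans (cv_norm_coord _ _) lbl.
  by have [] := NP i x x' (lt_le_trans xd dd1) (lt_le_trans xd' dd1).
have b4 : `|T4| <= k%:R * (Cl * (2 + `|lb|) * (`|x' - x| + `|u' - u|)) * (N * e).
  apply: norm_sum_scale => i; first exact: le_trans (cv_norm_coord _ _) ll'.
  have [h _] := NP i xb x' xbd1 (lt_le_trans xd' dd1).
  apply: (le_trans h); rewrite ler_wpM2l ?(ltW N0)// ltW//.
  by apply: (lt_le_trans xd'); apply: (le_trans dd6).
rewrite [leRHS]mulrCA -[leRHS]mulrA [e * _]mulrC mulrA -mulrA.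
rewrite ler_wpM2l ?(ltW CQ0)//.
have := ler_normD (T1 + T2 + T3) T4; have := ler_normD (T1 + T2) T3.
have := ler_normD T1 T2.
have p1 : 0 <= e * `|u' - u| by rewrite mulr_ge0// ltW.
have := mulr_ge0 (ltW c10) p1.
move: b1 b2 b3 b4; rewrite /c1 /c2.
move: (`|T1|) (`|T1 + T2|) (`|T1 + T2 + T3|) (`|T2|) (`|T3|) (`|T4|) (`|T1 + _ + _ + _|).
move: (`|u' - u|) (`|x' - x|) (`|lb|) (k%:R) => a b c p t1 t12 t123 t2 t3 t4 t; lra.
Qed.

(* D inverts [Q^T (1 + gam H) Q + B^T B], where Q = 1 - A B projects onto ker B
   along the range of a right inverse A of B = D Phi xb. *)
Theorem subdiff_linearization (gam : K) : 0 < gam ->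
  exists D : 'M[K]_n, forall e : K, 0 < e -> exists2 d : K, 0 < d &
    forall x x' u u', `|x - xb| < d -> `|x' - xb| < d ->
    `|u - ub| < d -> `|u' - ub| < d -> subdiff f x u -> subdiff f x' u' ->
    `|x' - x - D *m (x' - x + gam *: (u' - u))|
      <= e * `|x' - x + gam *: (u' - u)|.
Proof.
move=> gam0.
have [d1 d10 ident] := identification.
have [lb lbE] : exists l : 'cV[K]_k, ub - grad g xb = \sum_i l i 0 *: grad (Phi i) xb.
  have [d d0 mult] := normal_multiplier.
  by have := mult xb ub; rewrite subrr normr0; apply.
have [A BA] := constraint_jac_right_inverse surj.
pose Q : 'M[K]_n := 1%:M - A *m B.
have BQ : B *m Q = 0.
  by rewrite mulmxBr mulmx1 mulmxA -[constraint_jac Phi xb]/B in BA *; rewrite BA mul1mx subrr.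
have [Cp Cp0 projP] := projected_increment lbE BQ.
have psd := lagrangian_hess_psd lbE.
move: (lagrangian_hess lb) psd projP => H psd projP.
pose S := 1%:M + gam *: H.
pose G := Q^T *m S *m Q + B^T *m B.
(* [dotp (G *m v) v] is the sum of the nonnegative terms [|Q v|^2], [gam <H Q v, Q v>] and
   [|B v|^2]; if it vanishes, so does [v = Q v + A B v]. *)
have GU : G \in unitmx.
  apply: unitmx_of_ker => v Gv.
  have vE : v = Q *m v + A *m (B *m v).
    by rewrite mulmxBl mul1mx -mulmxA subrK.
  have : dotp (G *m v) v = 0 by rewrite Gv dotp0l.
  rewrite mulmxDl dotpDl -!mulmxA -!dotp_mulmxr mulmxDl mul1mx dotpDl -scalemxAl dotpZl.
  have BQv : B *m (Q *m v) = 0 by rewrite mulmxA BQ mul0mx.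
  have := mulr_ge0 (ltW gam0) (psd _ BQv).
  have := dotp_ge0 (Q *m v); have := dotp_ge0 (B *m v) => h1 h2 h3 h4.
  have Qv0 : Q *m v = 0 by apply: dotp_eq0; lra.
  have Bv0 : B *m v = 0 by apply: dotp_eq0; lra.
  by rewrite vE Qv0 Bv0 mulmx0 addr0.
exists (invmx G *m Q^T) => e e0.
have [CG CG0 GC] := mulmx_norm_bound (invmx G).
have [CR CR0 RC] := mulmx_norm_bound (Q^T *m S *m A).
have [CB CB0 BC] := mulmx_norm_bound B^T.
pose c1 := gam * Cp + CR + CB; pose c2 := gam * Cp.
have c20 : 0 < c2 by rewrite mulr_gt0.
have c10 : 0 < c1 by rewrite /c1 !addr_gt0.
pose Kc := c1 * n%:R + c2 * ((1 + n%:R) / gam) + 1.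
have n1 : 0 <= 1 + n%:R :> K by rewrite addr_ge0.
have Kc0 : 0 < Kc.
  by rewrite ltr_wpDl// addr_ge0// mulr_ge0 ?(ltW c10) ?(ltW c20)// divr_ge0// ltW.
pose e' := Num.min 1 (e / (CG * Kc)).
have e'0 : 0 < e' by rewrite lt_min ltr01 divr_gt0// mulr_gt0.
have e'1 : e' <= 1 by rewrite ge_min lexx.
have e'E : CG * (e' * Kc) <= e.
  by rewrite mulrCA -ler_pdivlMr ?mulr_gt0// ge_min lexx orbT.
have e'01 : 0 < e' <= 1 by rewrite e'0.
have [d2 d20 pincr] := projP e' e'01.
have [d3 d30 cincr] := constraint_increment e'0.
pose d := Num.min (Num.min d1 d2) d3.
have [dd1 dd2 dd3] : [/\ d <= d1, d <= d2 & d <= d3] by rewrite !ge_min !lexx !orbT.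
exists d => [|x x' u u' xd xd' ud ud' fxu fxu']; first by rewrite !lt_min d10 d20.
have Mx := ident x u (lt_le_trans xd dd1) (lt_le_trans ud dd1) fxu.
have Mx' := ident x' u' (lt_le_trans xd' dd1) (lt_le_trans ud' dd1) fxu'.
have h1 := pincr x x' u u' (lt_le_trans xd dd2) (lt_le_trans xd' dd2)
  (lt_le_trans ud dd2) (lt_le_trans ud' dd2) Mx Mx' fxu fxu'.
have h2 := cincr x x' (lt_le_trans xd dd3) (lt_le_trans xd' dd3) Mx Mx'.
have mono := subdiff_monotone pf fxu' fxu.
move: h1 h2 mono; move: (x' - x) (u' - u) => a b h1 h2 mono.
set E := a + gam *: b.
(* Monotonicity makes [dotp a b] nonnegative, so [|a|^2 <= dotp a E]: the proximal map is
   nonexpansive, up to the change of norm. *)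
have aE : `|a| <= n%:R * `|E|.
  have [->|a0] := eqVneq a 0; first by rewrite normr0 mulr_ge0.
  have na : 0 < `|a| by rewrite normr_gt0.
  rewrite -(ler_pM2l na); apply: (@le_trans _ _ (dotp a E)).
    rewrite -expr2; apply: (le_trans (sqr_norm_le_dotp a)).
    by rewrite dotpDr dotpZr lerDl mulr_ge0 ?(ltW gam0)// dotpC.
  apply: (le_trans (ler_norm _)); apply: (le_trans (dotp_norm_le _ _)).
  by rewrite mulrCA mulrA.
have bE : `|b| <= (1 + n%:R) / gam * `|E|.
  have : gam * `|b| <= (1 + n%:R) * `|E|.
    have -> : gam * `|b| = `|E - a|.
      by rewrite /E [a + _]addrC addrK normrZ gtr0_norm.
    by apply: (le_trans (ler_normB _ _)); rewrite mulrDl mul1r lerD.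
  by rewrite mulrAC ler_pdivlMr// mulrC.
(* From [Q a = a - A B a]: what is left is the projected increment and terms in [B *m a], all
   small. *)
have GE : G *m a - Q^T *m E =
    - (gam *: (Q^T *m (b - H *m a))) - Q^T *m S *m A *m (B *m a) + B^T *m (B *m a).
  have Qa : Q *m a = a - A *m (B *m a) by rewrite mulmxBl mul1mx mulmxA.
  rewrite mulmxDl -[Q^T *m S *m Q *m a]mulmxA Qa mulmxBr -!mulmxA.
  rewrite /S !mulmxDl !mul1mx -!scalemxAl /E !(mulmxBr, mulmxDr) -!scalemxAr.
  move: (Q^T *m a) (Q^T *m (H *m a)) (Q^T *m b) (B^T *m (B *m a)) => p q r t.
  move: (Q^T *m (A *m (B *m a))) (Q^T *m (H *m (A *m (B *m a)))) => s v.
  by apply/matrixP => i j; rewrite !mxE; ring.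
have -> : a - invmx G *m Q^T *m E = invmx G *m (G *m a - Q^T *m E).
  by rewrite mulmxBr mulmxA mulVmx// mul1mx mulmxA.
apply: (le_trans (GC _)).
have nG : `|G *m a - Q^T *m E| <= e' * (Kc * `|E|).
  have r1 := RC (B *m a); have r2 := BC (B *m a).
  have r3 : `|gam *: (Q^T *m (b - H *m a))| <= gam * (e' * (Cp * (`|a| + `|b|))).
    by rewrite normrZ gtr0_norm// ler_wpM2l// ltW.
  have r4 : `|G *m a - Q^T *m E| <= e' * (c1 * `|a| + c2 * `|b|).
    rewrite GE; move: r1 r2 r3.
    set X1 := gam *: _; set X2 := _ *m (B *m a); set X3 := B^T *m _ => r1 r2 r3.
    have := ler_normD (- X1 - X2) X3; have := ler_normB (- X1) X2; rewrite normrN.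
    have := ler_wpM2l (ltW CR0) h2; have := ler_wpM2l (ltW CB0) h2.
    move: r1 r2 r3; rewrite /c1 /c2; lra.
  apply: (le_trans r4); rewrite ler_wpM2l ?(ltW e'0)// /Kc.
  have := ler_wpM2l (ltW c10) aE; have := ler_wpM2l (ltW c20) bE.
  have := normr_ge0 E; move: ((1 + n%:R) / gam) (n%:R) => p q; lra.
apply: (le_trans (ler_wpM2l (ltW CG0) nG)).
by rewrite !mulrA ler_wpM2r// -mulrA.
Qed.

End PartlySmoothLocal.

Lemma partly_smooth_linearization (K : realType) n (f : 'cV[K]_n -> \bar K)
    (xb ub : 'cV[K]_n) (M : set 'cV[K]_n) (gam : K) :
  proper f -> subdiff f xb ub -> partly_smooth f xb M -> ri (subdiff f xb) ub ->
  0 < gam ->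
  exists D : 'M[K]_n, forall e : K, 0 < e -> exists2 d : K, 0 < d &
    forall x x' u u', `|x - xb| < d -> `|x' - xb| < d ->
    `|u - ub| < d -> `|u' - ub| < d -> subdiff f x u -> subdiff f x' u' ->
    `|x' - x - D *m (x' - x + gam *: (u' - u))|
      <= e * `|x' - x + gam *: (u' - u)|.
Proof.
move=> pf fub [[Mxb [V [k [Phi [oV Vxb PhiV surj MV]]]]] [V' [g [oV' V'xb gV' fg]]] sharp cont].
move=> nondeg gam0.
apply: (@subdiff_linearization K n k f M (V `&` V') xb ub Phi g) => //.
- exact: openI.
- by move=> i x [Vx _]; exact: PhiV.
- by move=> x [_ V'x]; exact: gV'.
- exact: surj.
- by move=> y [Vy _]; exact: MV.
- by move=> y [_ V'y]; exact: fg.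
Qed.

Lemma cvg_seq_dist (K : realType) n (x : nat -> 'cV[K]_n) (l : 'cV[K]_n) (e : K) :
  x @ \oo --> l -> 0 < e -> exists N, forall k, (N <= k)%N -> `|x k - l| < e.
Proof. by move=> /cvgrPdistC_lt xl e0; have [N _ NP] := xl e e0; exists N. Qed.

(** * Composition of the two linearized proximal steps *)

Section PrimalDualRate.
Context {K : realType} {n m : nat}.
Variables (L : 'M[K]_(m, n)) (gR gJ : K).
Hypotheses (HgR : 0 < gR) (HgJ : 0 < gJ).

Let primal_sub (x x' : 'cV[K]_n) (w : 'cV[K]_m) :=
  gR^-1 *: (x - gR *: (L^T *m w) - x').
Let dual_sub (x x' : 'cV[K]_n) (w w' : 'cV[K]_m) :=
  gJ^-1 *: (w + gJ *: (L *m (x' + (x' - x))) - w').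

(** Brings the subgradients produced by the iteration close to those of the non-degeneracy
    condition. With [1 <= C], a bound on [C * d] also bounds [d]. *)
Lemma pd_subgradients_near xs ws : exists2 C : K, 1 <= C &
  forall x x' w w' d, `|x - xs| < d -> `|x' - xs| < d ->
    `|w - ws| < d -> `|w' - ws| < d ->
    `|primal_sub x x' w - (- (L^T *m ws))| <= C * d /\
    `|dual_sub x x' w w' - L *m xs| <= C * d.
Proof.
have [C C0 LC] := mulmx_norm_bound L; have [C' C'0 LC'] := mulmx_norm_bound L^T.
have r0 : 0 < gR^-1 by rewrite invr_gt0.
have j0 : 0 < gJ^-1 by rewrite invr_gt0.
exists (1 + 2 * gR^-1 + C' + 2 * gJ^-1 + 3 * C); first by lra.
move=> x x' w w' d xd xd' wd wd'.
have d0 : 0 <= d by apply: le_trans (ltW xd).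
have nx : `|x - x'| <= 2 * d.
  have -> : x - x' = (x - xs) - (x' - xs) by rewrite opprB addrA subrK.
  by apply: (le_trans (ler_normB _ _)); lra.
have nw : `|w - w'| <= 2 * d.
  have -> : w - w' = (w - ws) - (w' - ws) by rewrite opprB addrA subrK.
  by apply: (le_trans (ler_normB _ _)); lra.
split.
  have -> : primal_sub x x' w - (- (L^T *m ws)) =
      gR^-1 *: (x - x') - L^T *m (w - ws).
    rewrite /primal_sub mulmxBr; move: (L^T *m _) (L^T *m _) => p q.
    by apply/matrixP => i t; rewrite !mxE; field; rewrite gt_eqF.
  apply: (le_trans (ler_normB _ _)); rewrite normrZ gtr0_norm//.
  have := ler_wpM2l (ltW r0) nx; have := LC' (w - ws).
  have := ler_wpM2l (ltW C'0) (ltW wd).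
  have := mulr_ge0 (ltW j0) d0; have := mulr_ge0 (ltW C0) d0.
  by move: (gR^-1) (gJ^-1) => r j; lra.
have -> : dual_sub x x' w w' - L *m xs =
    gJ^-1 *: (w - w') + L *m ((x' - xs) - (x - x')).
  rewrite /dual_sub !(mulmxBr, mulmxDr); move: (L *m _) (L *m _) (L *m _) => p q s.
  by apply/matrixP => i t; rewrite !mxE; field; rewrite gt_eqF.
apply: (le_trans (ler_normD _ _)); rewrite normrZ gtr0_norm//.
have := ler_wpM2l (ltW j0) nw; have := LC ((x' - xs) - (x - x')).
have := ler_wpM2l (ltW C0) (ler_normB (x' - xs) (x - x')).
have := ler_wpM2l (ltW C0) (ltW xd'); have := ler_wpM2l (ltW C0) nx.
have := mulr_ge0 (ltW r0) d0; have := mulr_ge0 (ltW C'0) d0.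
by move: (gR^-1) (gJ^-1) => r j; lra.
Qed.

(** Obtained by eliminating [a'] from [a' = DR (a - gR L^T b)] and
    [b' = DJ (b + gJ L (2 a' - a))]. *)
Definition pd_matrix (DR : 'M[K]_n) (DJ : 'M[K]_m) : 'M[K]_(n + m) :=
  block_mx DR (- gR *: (DR *m L^T))
    (gJ *: (DJ *m L *m (2 *: DR - 1%:M)))
    (DJ *m (1%:M - (2 * gJ * gR) *: (L *m DR *m L^T))).

Lemma pd_matrix_mul DR DJ (a : 'cV[K]_n) (b : 'cV[K]_m) :
  let a' := DR *m (a - gR *: (L^T *m b)) in
  pd_matrix DR DJ *m col_mx a b = col_mx a' (DJ *m (b + gJ *: (L *m (a' + (a' - a))))).
Proof.
move=> a'; rewrite mul_block_col; congr col_mx.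
  by rewrite /a' mulmxBr -scalemxAl -scalemxAr scaleNr !mulmxA.
rewrite -scalemxAl -!mulmxA mulmxBl -scalemxAl mul1mx.
rewrite mulmxBl -scalemxAl mul1mx -!mulmxA scalemxAr -mulmxDr; congr (_ *m _).
rewrite /a' !(mulmxBr, mulmxDr, mulmxN) -!scalemxAr.
move: (L *m (DR *m a)) (L *m a) (L *m (DR *m (L^T *m b))) => p q r.
by apply/matrixP => i t; rewrite !mxE; ring.
Qed.

Lemma pd_matrix_error (DR : 'M[K]_n) (DJ : 'M[K]_m) : exists2 C : K, 0 < C &
  forall (a a' : 'cV[K]_n) (b b' : 'cV[K]_m) e, 0 < e <= 1 ->
  `|a' - DR *m (a - gR *: (L^T *m b))| <= e * `|a - gR *: (L^T *m b)| ->
  `|b' - DJ *m (b + gJ *: (L *m (a' + (a' - a))))|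
    <= e * `|b + gJ *: (L *m (a' + (a' - a)))| ->
  `|col_mx a' b' - pd_matrix DR DJ *m col_mx a b| <= e * (C * `|col_mx a b|).
Proof.
have [CL CL0 LC] := mulmx_norm_bound L; have [C' C'0 LC'] := mulmx_norm_bound L^T.
have [CR CR0 RC] := mulmx_norm_bound DR.
have [CJ CJ0 JC] := mulmx_norm_bound (DJ *m L).
(* [c1] and [c2] bound the increments [E1], [E2] of the two prox arguments; [c3] bounds the primal
   error carried through the dual step. *)
pose c1 := 1 + gR * C'; have c10 : 0 < c1 by rewrite addr_gt0// mulr_gt0.
pose c2 := 1 + gJ * CL * (2 * (CR + 1) * c1 + 1).
have c20 : 0 < c2 by rewrite addr_gt0// !mulr_gt0// addr_gt0// !mulr_gt0// addr_gt0.
pose c3 := 2 * gJ * CJ * c1; have c30 : 0 < c3 by rewrite !mulr_gt0.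
exists (c1 + c2 + c3); first by rewrite addr_gt0// addr_gt0.
move=> a a' b b' e /andP[e0 e1]; set E1 := a - _; set E2 := b + _ => h1 h2.
set N := `|col_mx a b|.
have [aN bN] : `|a| <= N /\ `|b| <= N.
  by rewrite /N norm_col_mx !le_max !lexx orbT.
have N0 : 0 <= N := normr_ge0 _.
have E1N : `|E1| <= c1 * N.
  apply: (le_trans (ler_normB _ _)); rewrite normrZ gtr0_norm//.
  have := ler_wpM2l (ltW HgR) (le_trans (LC' b) (ler_wpM2l (ltW C'0) bN)).
  by rewrite /c1; lra.
have aN' : `|a'| <= (CR + 1) * c1 * N.
  have := ler_normD (a' - DR *m E1) (DR *m E1); rewrite subrK.
  have := RC E1; have := ler_wpM2l (ltW CR0) E1N.
  have := ler_wpM2r (normr_ge0 E1) e1; lra.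
have E2N : `|E2| <= c2 * N.
  apply: (le_trans (ler_normD _ _)); rewrite normrZ gtr0_norm//.
  have : `|L *m (a' + (a' - a))| <= CL * ((2 * (CR + 1) * c1 + 1) * N).
    apply: (le_trans (LC _)); rewrite ler_wpM2l ?(ltW CL0)//.
    by have := ler_normD a' (a' - a); have := ler_normB a' a; lra.
  by move/(ler_wpM2l (ltW HgJ)); rewrite /c2; lra.
have c1N := mulr_ge0 (ltW c10) N0; have c2N := mulr_ge0 (ltW c20) N0.
have c3N := mulr_ge0 (ltW c30) N0.
rewrite pd_matrix_mul opp_col_mx add_col_mx norm_col_mx ge_max -/E1.
apply/andP; split.
  by apply: (le_trans h1); rewrite ler_wpM2l ?(ltW e0)//; lra.
set a1 := DR *m E1 in h1 *.
(* The dual argument contains the true [a'], the matrix its linearization [a1]; extrapolation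
   doubles the discrepancy. *)
have -> : b' - DJ *m (b + gJ *: (L *m (a1 + (a1 - a)))) =
    (b' - DJ *m E2) + (2 * gJ) *: (DJ *m L *m (a' - a1)).
  rewrite /E2 !(mulmxBr, mulmxDr, mulmxN) -!scalemxAr !(mulmxBr, mulmxDr, mulmxN) !mulmxA.
  move: (DJ *m L *m a') (DJ *m L *m a1) (DJ *m L *m a) (DJ *m b) => p q r s.
  by apply/matrixP => i t; rewrite !mxE; ring.
apply: (le_trans (ler_normD _ _)); rewrite normrZ gtr0_norm ?mulr_gt0//.
have := le_trans h2 (ler_wpM2l (ltW e0) E2N).
have := le_trans h1 (ler_wpM2l (ltW e0) E1N) => /(ler_wpM2l (ltW CJ0)).
move/(le_trans (JC _))/(ler_wpM2l (mulr_ge0 (ler0n K 2) (ltW HgJ))).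
have := mulr_ge0 (ltW e0) c1N; rewrite /c3; lra.
Qed.

End PrimalDualRate.

(** * Convergence and local linearization of the iteration *)

Theorem theorem3p16 (K : realType) (n m : nat)
  (R : 'cV[K]_n -> \bar K) (J : 'cV[K]_m -> \bar K) (L : 'M[K]_(m, n))
  (gR gJ tau : K) (x0 : 'cV[K]_n) (w0 : 'cV[K]_m)
  (x xbar : nat -> 'cV[K]_n) (w : nat -> 'cV[K]_m)
  (HR : proper_convex_lsc R) (HJ : proper_convex_lsc J)
  (H0 : sv_ran (fun y : 'cV[K]_n =>
          [set u + L^T *m v | u in subdiff R y & v in subdiff J (L *m y)]) 0)
  (HgR : 0 < gR) (HgJ : 0 < gJ) (Htau : 0 <= tau <= 1)
  (Hx0 : x 0%N = x0) (Hw0 : w 0%N = w0)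
  (Hiter : primal_dual_iteration R J L gR gJ tau x xbar w)
  (Htau1 : tau = 1) (Hstep : gR * gJ * opnorm L ^+ 2 < 1) :
  exists (xs : 'cV[K]_n) (ws : 'cV[K]_m),
    [/\ primal_sol R J L xs,
        dual_sol R J L ws,
        x @ \oo --> xs,
        w @ \oo --> ws
      & forall (MR : set 'cV[K]_n) (MJ : set 'cV[K]_m),
          partly_smooth R xs MR ->
          partly_smooth (fenchel J) ws MJ ->
          ri (subdiff R xs) (- (L^T *m ws)) ->
          ri (subdiff (fenchel J) ws) (L *m xs) ->
          let z := fun k => col_mx (x k) (w k) in
          exists MPD : 'M[K]_(n + m),
            (fun k => z k.+2 - z k.+1)
              = (fun k => MPD *m (z k.+1 - z k))
                +o_\oo (fun k => enorm (z k.+1 - z k))].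
Proof.
rewrite {}Htau1 in Hiter.
have [[pR _ _] [pJ _ _]] := (HR, HJ).
have [xs [ws [Rs Js xcv wcv]]] := pd_converges HR HJ H0 HgR HgJ Hiter Hstep.
exists xs, ws; have [? ?] := pd_optimality pR pJ Rs Js; split => //.
move=> MR MJ psR psJ riR riJ z.
have pF := pd_proper_fenchel HJ H0.
have stepR := pd_step_primal HR HgR Hiter.
have stepJ := pd_step_dual HJ H0 HgJ Hiter.
have [DR DRP] := partly_smooth_linearization pR Rs psR riR HgR.
have [DJ DJP] := partly_smooth_linearization pF (subdiff_fenchel pJ Js) psJ riJ HgJ.
exists (pd_matrix L gR gJ DR DJ); apply/eqaddoP => eps eps0.
have [C C0 err] := pd_matrix_error L HgR HgJ DR DJ.
pose e := Num.min 1 (eps / C).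
have e0 : 0 < e by rewrite lt_min ltr01 divr_gt0.
have e01 : 0 < e <= 1 by rewrite e0 ge_min lexx.
have eC : e * C <= eps by rewrite -ler_pdivlMr// ge_min lexx orbT.
have [dR dR0 {}DRP] := DRP e e0; have [dJ dJ0 {}DJP] := DJP e e0.
have [Cn Cn1 near] := pd_subgradients_near L HgR HgJ xs ws.
have Cn0 : 0 < Cn by apply: lt_le_trans Cn1.
(* [Cn] accounts for the subgradients, and the factor 2 makes the bound strict. *)
pose d0 := Num.min dR dJ / (2 * Cn).
have mn0 : 0 < Num.min dR dJ by rewrite lt_min dR0.
have d00 : 0 < d0 by rewrite divr_gt0// mulr_gt0.
have Cd : Cn * d0 < Num.min dR dJ.
  have -> : Cn * d0 = Num.min dR dJ / 2 by rewrite /d0; field; rewrite gt_eqF.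
  by rewrite ltr_pdivrMr//; lra.
have dd : d0 < Num.min dR dJ by apply: le_lt_trans Cd; rewrite ler_peMl// ltW.
have [Nx NxP] := cvg_seq_dist xcv d00; have [Nw NwP] := cvg_seq_dist wcv d00.
exists (maxn Nx Nw) => // k /=; rewrite geq_max => /andP[kx kw].
have xk j : (k <= j)%N -> `|x j - xs| < d0 by move=> kj; apply: NxP; exact: leq_trans kj.
have wk j : (k <= j)%N -> `|w j - ws| < d0 by move=> kj; apply: NwP; exact: leq_trans kj.
have k1 : (k <= k.+1)%N by [].
have k2 : (k <= k.+2)%N by rewrite ltnW.
(* The subgradients at [k.+1] and [k.+2] involve three consecutive iterates, all within [d0] of the
   limit. *)
have [u1 v1] := near _ _ _ _ _ (xk _ (leqnn k)) (xk _ k1) (wk _ (leqnn k)) (wk _ k1).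
have [u2 v2] := near _ _ _ _ _ (xk _ k1) (xk _ k2) (wk _ k1) (wk _ k2).
have [mR mJ] : Num.min dR dJ <= dR /\ Num.min dR dJ <= dJ by rewrite !ge_min !lexx orbT.
have sm a : a < d0 -> a < dR /\ a < dJ.
  by move=> ad; split; apply: lt_le_trans (lt_trans ad dd) _.
have sC a : a <= Cn * d0 -> a < dR /\ a < dJ.
  by move=> ad; split; apply: lt_le_trans (le_lt_trans ad Cd) _.
have := DRP _ _ _ _ (sm _ (xk _ k1)).1 (sm _ (xk _ k2)).1 (sC _ u1).1 (sC _ u2).1
  (stepR k) (stepR k.+1).
have := DJP _ _ _ _ (sm _ (wk _ k1)).2 (sm _ (wk _ k2)).2 (sC _ v1).2 (sC _ v2).2
  (stepJ k) (stepJ k.+1).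
(* A point plus the step size times its subgradient is the prox argument, so the linearization
   speaks of the increment of that argument. *)
have -> : w k.+2 - w k.+1 + gJ *: (gJ^-1 *: (w k.+1 + gJ *: (L *m (x k.+2 + (x k.+2 - x k.+1))) -
    w k.+2) - gJ^-1 *: (w k + gJ *: (L *m (x k.+1 + (x k.+1 - x k))) - w k.+1)) =
    (w k.+1 - w k) + gJ *: (L *m ((x k.+2 - x k.+1) + ((x k.+2 - x k.+1) - (x k.+1 - x k)))).
  rewrite !(mulmxBr, mulmxDr); move: (L *m _) (L *m _) (L *m _) => p q r.
  by apply/matrixP => i j; rewrite !mxE; field; rewrite gt_eqF.
have -> : x k.+2 - x k.+1 + gR *: (gR^-1 *: (x k.+1 - gR *: (L^T *m w k.+1) - x k.+2) -
    gR^-1 *: (x k - gR *: (L^T *m w k) - x k.+1)) =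
    (x k.+1 - x k) - gR *: (L^T *m (w k.+1 - w k)).
  rewrite mulmxBr; move: (L^T *m _) (L^T *m _) => p q.
  by apply/matrixP => i j; rewrite !mxE; field; rewrite gt_eqF.
move=> hJ hR; have := err _ _ _ _ e e01 hR hJ.
have zE j : col_mx (x j.+1 - x j) (w j.+1 - w j) = z j.+1 - z j.
  by rewrite /z opp_col_mx add_col_mx.
rewrite !zE => /le_trans; apply; rewrite mulrA ger0_norm ?enorm_ge0//.
apply: ler_pM => //; first by rewrite mulr_ge0// ltW.
exact: norm_le_enorm.
Qed.
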